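(* Let $\gamma$ be Euler's constant. If the inequality $$\{d_{2^n}L_{n,2^n}\}>6\cdot\Big(\frac{128}{729}\Big)^{2^{n-1}}$$ holds for infinitely many positive integers $n$, then $\gamma$ is irrational. Moreover, if this inequality holds for a given integer $n>0$ and $\gamma$ is rational, then the denominator of $\gamma$ (in lowest terms) does not divide $2^{2^n}d_{2^n}$.
   Context: $d_N$ denotes the least common multiple of $1,2,\dots,N$, and $\{x\}$ the fractional part of $x$. For real $q>1$ the $q$-logarithm is $\ln_q(1+z)=\sum_{\mu=1}^\infty \frac{(-1)^{\mu-1}z^\mu}{q^\mu-1}$ for $|z|<q$. For integers $n\ge0$ and $0\le m\le 2^{n+1}$ define $$L_{n,m}=2^m n\log 2+\sum_{j=2}^m\binom mj\sum_{k=1}^{j-1}\frac{(-1)^{k-1}}k\ln_2\Big(1+\frac k{2^n}\Big).$$ Empty sums are zero. *)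

(* Defs.v *)
From mathcomp Require Import all_boot all_order all_algebra.
From mathcomp Require Import all_classical all_reals all_analysis.

Set Implicit Arguments.
Unset Strict Implicit.
Unset Printing Implicit Defensive.

Import Order.TTheory GRing.Theory Num.Theory.
Import numFieldNormedType.Exports.

Local Open Scope classical_set_scope.
Local Open Scope ring_scope.

Definition lcm_upto (N : nat) : nat := \big[lcmn/1%N]_(1 <= i < N.+1) i.

Section Defs.
Variable R : realType.
Implicit Types (q x : R) (n m N : nat).

Definition frac_part x : R := x - (Num.floor x)%:~R.

(* [series harmonic N] is 1 + 1/2 + ... + 1/N *)
Definition euler_gamma : R := limn (fun N => series harmonic N - ln N%:R).

(* ln_q x, as the power series in z = x - 1; the summation index mu >= 1 is
   written i.+1.  Only meaningful for 1 < q and `|x - 1| < q, where the series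
   converges. *)
Definition qln q x : R :=
  limn (series (fun i : nat => (-1) ^+ i * (x - 1) ^+ i.+1 / (q ^+ i.+1 - 1))).

(* Meant for m <= 2 ^ n.+1, so that every k / 2 ^ n below is less than 2, i.e.
   qln 2 is evaluated inside its disc of convergence. *)
Definition qlog_form n m : R :=
  2 ^+ m * n%:R * ln 2 +
  \sum_(2 <= j < m.+1) 'C(m, j)%:R *
    \sum_(1 <= k < j) (-1) ^+ k.-1 / k%:R * qln 2 (1 + k%:R / 2 ^+ n).

End Defs.

Arguments euler_gamma R : clear implicits.
Arguments qlog_form R n m : clear implicits.

(* Main.v *)
From Stdlib Require Import NArith ZArith.
Require Import Defs.
From mathcomp Require Import all_boot all_order all_algebra.
From mathcomp Require Import all_classical all_reals all_analysis.
From mathcomp Require Import ssrZ zify ring lra.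

Set Implicit Arguments.
Unset Strict Implicit.
Unset Printing Implicit Defensive.

Import Order.TTheory GRing.Theory Num.Theory.
Import numFieldNormedType.Exports.

Local Open Scope classical_set_scope.
Local Open Scope ring_scope.

(* Write N = 2^n, d = lcm(1..N), H = 1 + 1/2 + ... + 1/N, and
   T(a) = 1/a - 1/(a+1) + 1/(a+2) - ...  Since
   T(2a) = 1/(2a) - ln 2 + H_(2a) - H_a, the sum of T(2^v) over v > n telescopes
   to gamma - H + n ln 2 + 1/N.  Expanding the m-th difference
   sum_j C(m,j) (-1)^j T(a+j) = int_0^1 x^(a-1) (1-x)^m / (1+x) dx at a = 2^v
   and summing over v > n, the partial sums of T produce the q-logarithms,
   because ln_2(1+z) = sum_(v>0) z / (2^v + z).  Hence, for m = N,
     L_(n,N) = 2^N H - 1/N - 2^N gamma + I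
   with 0 <= I <= B(2N, N) <= 6 (4/27)^N.  If the denominator of gamma divides
   2^N d, the fractional part of d L_(n,N) is therefore at most d I, and
   d <= 8^(N/2) gives the contradiction.
   The estimate d <= 8^(N/2) amounts to psi(N) <= 1.0398 N, which is stronger
   than what Chebyshev's identity with few terms gives.  It follows from
   Chebyshev's method with an optimised set of integer weights, the range
   N <= 2^14 being checked by computation. *)

(** * The Chebyshev psi function *)

Lemma lcm_upto0 : lcm_upto 0 = 1%N.
Proof. by rewrite /lcm_upto big_geq. Qed.

Lemma lcm_uptoS n : lcm_upto n.+1 = lcmn (lcm_upto n) n.+1.
Proof. by rewrite /lcm_upto big_nat_recr. Qed.

Lemma lcm_upto_gt0 n : (0 < lcm_upto n)%N.
Proof. by elim: n => [|n IHn]; rewrite ?lcm_upto0 // lcm_uptoS lcmn_gt0 IHn. Qed.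

Lemma dvdn_lcm_upto n i : (0 < i <= n)%N -> (i %| lcm_upto n)%N.
Proof.
elim: n => [|n IHn] /andP[i_gt0 le_in]; first by rewrite leqNgt i_gt0 in le_in.
rewrite lcm_uptoS; move: le_in; rewrite leq_eqVlt => /predU1P[->|lt_in].
  exact: dvdn_lcmr.
by apply: dvdn_trans (dvdn_lcml _ _); apply: IHn; rewrite i_gt0.
Qed.

Lemma logn_lcm_upto p n : prime p -> logn p (lcm_upto n) = trunc_log p n.
Proof.
move=> p_pr; have p_gt1 := prime_gt1 p_pr.
elim: n => [|n IHn]; first by rewrite lcm_upto0 logn1 trunc_log0.
rewrite lcm_uptoS logn_lcm ?lcm_upto_gt0 // IHn; apply/eqP.
rewrite eqn_leq geq_max leq_trunc_log //=; apply/andP; split.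
  by rewrite trunc_log_max // dvdn_leq // pfactor_dvdnn.
have := trunc_logP p_gt1 (ltn0Sn n); set k := trunc_log p n.+1.
rewrite leq_eqVlt => /predU1P[eq_n|lt_n].
  by rewrite -eq_n pfactorK // leq_maxr.
by rewrite leq_max trunc_log_max.
Qed.

Lemma trunc_log_sum p n m : (1 < p)%N -> (0 < m <= n)%N ->
  trunc_log p m = (\sum_(1 <= i < n.+1) (p ^ i <= m))%N.
Proof.
move=> p_gt1 /andP[m_gt0 le_mn]; set k := trunc_log p m.
have le_kn : (k <= n)%N.
  apply: leq_trans le_mn; apply: leq_trans (trunc_logP p_gt1 m_gt0).
  exact/ltnW/ltn_expl.
rewrite (big_cat_nat (n := k.+1)) //= [X in (_ + X)%N]big1_seq; last first.
  move=> i /andP[_]; rewrite mem_index_iota => /andP[lt_ki _].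
  by rewrite leqNgt (leq_trans (trunc_log_ltn m p_gt1)) // leq_exp2l.
rewrite addn0 (eq_big_nat _ _ (F2 := fun=> 1%N)).
  by rewrite sum_nat_const_nat muln1 subSS subn0.
move=> i /andP[_ le_ik]; rewrite (leq_trans _ (trunc_logP p_gt1 m_gt0)) //.
by rewrite leq_exp2l.
Qed.

Lemma sum_leq_nat n m : (m <= n)%N -> (\sum_(1 <= k < n.+1) (k <= m))%N = m.
Proof.
move=> le_mn; rewrite (big_cat_nat (n := m.+1)) //= [X in (_ + X)%N]big1_seq.
  rewrite addn0 (eq_big_nat _ _ (F2 := fun=> 1%N)).
    by rewrite sum_nat_const_nat muln1 subSS subn0.
  by move=> i /andP[_]; rewrite ltnS => ->.
move=> i /andP[_]; rewrite mem_index_iota => /andP[lt_mi _].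
by rewrite leqNgt lt_mi.
Qed.

(** Chebyshev's identity ln n! = sum_k psi(n / k) in multiplicative form. Prime by prime, Legendre's
    formula gives the sum of floor(n / p^i), and floor(n / p^i) counts the k with p^i <= n / k. *)
Lemma fact_prod_lcm_upto n : n`! = (\prod_(1 <= k < n.+1) lcm_upto (n %/ k))%N.
Proof.
apply: eqn_from_log; rewrite ?fact_gt0 //.
  by rewrite big_seq; apply: prodn_cond_gt0 => i _; apply: lcm_upto_gt0.
move=> p; have [p_pr|p_npr] := boolP (prime p); last first.
  by rewrite [LHS]lognE [RHS]lognE (negPf p_npr).
have p_gt1 := prime_gt1 p_pr.
rewrite logn_fact //.
have -> : logn p (\prod_(1 <= k < n.+1) lcm_upto (n %/ k)) =
    (\sum_(1 <= k < n.+1) trunc_log p (n %/ k))%N.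
  elim: (index_iota _ _) => [|k s IHs]; first by rewrite !big_nil logn1.
  rewrite !big_cons lognM ?lcm_upto_gt0 ?IHs ?logn_lcm_upto //.
  by rewrite big_seq; apply: prodn_cond_gt0 => i _; apply: lcm_upto_gt0.
transitivity (\sum_(1 <= k < n.+1) \sum_(1 <= i < n.+1) (p ^ i <= n %/ k))%N.
  rewrite exchange_big; apply: eq_big_nat => i /andP[i_gt0 le_in] /=.
  rewrite -[LHS](sum_leq_nat (leq_div n (p ^ i))); apply: eq_big_nat => k.
  move=> /andP[k_gt0 _]; rewrite !leq_divRL ?expn_gt0 ?(ltnW p_gt1) //.
  by rewrite mulnC.
apply: eq_big_nat => k /andP[k_gt0 le_kn]; rewrite (@trunc_log_sum p n) //.
by rewrite leq_div divn_gt0 // -ltnS le_kn.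
Qed.

Section Psi.
Variable R : realType.
Implicit Types (n m k j : nat).

Definition cheb_psi n : R := ln (lcm_upto n)%:R.
Definition ln_fact n : R := ln (n`!)%:R.
(** The von Mangoldt function, taken as the increment of psi so that psi is a telescoping sum; it
    vanishes at 0 because [0.-1] is 0. *)
Definition mangoldt j : R := cheb_psi j - cheb_psi j.-1.

Lemma cheb_psi0 : cheb_psi 0 = 0.
Proof. by rewrite /cheb_psi lcm_upto0 ln1. Qed.

Lemma mangoldt_ge0 j : 0 <= mangoldt j.
Proof.
case: j => [|j]; first by rewrite /mangoldt subrr.
rewrite subr_ge0 ler_ln ?posrE ?ltr0n ?lcm_upto_gt0 // ler_nat.
by rewrite dvdn_leq ?lcm_upto_gt0 // lcm_uptoS dvdn_lcml.
Qed.

Lemma cheb_psi_sum n m : (m <= n)%N ->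
  cheb_psi m = \sum_(1 <= j < n.+1) mangoldt j * (j <= m)%N%:R.
Proof.
move=> le_mn; rewrite (big_cat_nat (n := m.+1)) //= [X in _ + X]big1_seq; last first.
  move=> j /andP[_]; rewrite mem_index_iota => /andP[lt_mj _].
  by rewrite leqNgt lt_mj mulr0.
rewrite addr0 (eq_big_nat _ _ (F2 := mangoldt)); last first.
  by move=> j /andP[_]; rewrite ltnS => ->; rewrite mulr1.
elim: m {le_mn} => [|m IHm]; first by rewrite big_geq // cheb_psi0.
by rewrite big_nat_recr //= -IHm /mangoldt /= addrC subrK.
Qed.

Lemma ln_prod_nat (I : eqType) (s : seq I) (F : I -> nat) :
  (forall i, i \in s -> (0 < F i)%N) ->
  ln (\prod_(i <- s) F i)%N%:R = \sum_(i <- s) ln (F i)%:R :> R.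
Proof.
elim: s => [|i s IHs] F_gt0; first by rewrite !big_nil ln1.
rewrite !big_cons natrM lnM ?IHs ?posrE ?ltr0n ?F_gt0 ?mem_head //.
  by move=> j js; rewrite F_gt0 // in_cons js orbT.
rewrite big_seq; apply: prodn_cond_gt0 => j js.
by rewrite F_gt0 // in_cons js orbT.
Qed.

(** The range extends to n rather than m, so that the expansions at different floors of n share one
    index set; the extra quotients are 0. *)
Lemma ln_fact_mangoldt n m : (m <= n)%N ->
  ln_fact m = \sum_(1 <= j < n.+1) mangoldt j * (m %/ j)%:R.
Proof.
move=> le_mn.
rewrite /ln_fact fact_prod_lcm_upto ln_prod_nat => [|i _]; last exact: lcm_upto_gt0.
transitivity (\sum_(1 <= k < m.+1) \sum_(1 <= j < n.+1)
    mangoldt j * (j <= m %/ k)%N%:R).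
  by apply: eq_bigr => k _; rewrite -cheb_psi_sum // (leq_trans (leq_div _ _)).
rewrite exchange_big; apply: eq_big_nat => j /andP[j_gt0 _] /=.
rewrite -mulr_sumr; congr (_ * _).
rewrite -[in RHS](sum_leq_nat (leq_div m j)) natr_sum.
by apply: eq_big_nat => k /andP[k_gt0 _]; rewrite !leq_divRL // mulnC.
Qed.

(* Lambda(j) enters both sides with a coefficient depending only on
   m = n / j, so an inequality between these coefficients suffices. *)
Lemma cheb_psi_le_weights (q : R) (s t : seq (nat * R)) n :
  (forall m, (0 < m)%N ->
    q <= \sum_(w <- s) w.2 * (m %/ w.1)%:R +
         \sum_(w <- t) w.2 * (w.1 <= m)%N%:R) ->
  all (fun w => 0 < w.1)%N s -> all (fun w => 0 < w.1)%N t ->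
  q * cheb_psi n <= \sum_(w <- s) w.2 * ln_fact (n %/ w.1) +
                    \sum_(w <- t) w.2 * cheb_psi (n %/ w.1).
Proof.
move=> ge_q /allP s_gt0 /allP t_gt0.
rewrite {1}(cheb_psi_sum (leqnn n)) mulr_sumr.
have -> : \sum_(w <- s) w.2 * ln_fact (n %/ w.1) =
   \sum_(1 <= j < n.+1) mangoldt j * \sum_(w <- s) w.2 * ((n %/ j) %/ w.1)%:R.
  under [RHS]eq_bigr do rewrite mulr_sumr.
  rewrite exchange_big; apply: eq_bigr => w _.
  rewrite (ln_fact_mangoldt (leq_div n w.1)) mulr_sumr.
  by apply: eq_bigr => j _; rewrite -!divnMA mulnC mulrCA.
have -> : \sum_(w <- t) w.2 * cheb_psi (n %/ w.1) =
   \sum_(1 <= j < n.+1) mangoldt j * \sum_(w <- t) w.2 * (w.1 <= n %/ j)%N%:R.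
  under [RHS]eq_bigr do rewrite mulr_sumr.
  rewrite exchange_big; apply: eq_big_seq => w wt.
  rewrite (cheb_psi_sum (leq_div n w.1)) mulr_sumr.
  apply: eq_big_nat => j /andP[j_gt0 _].
  by rewrite !leq_divRL ?t_gt0 // mulnC mulrCA.
rewrite -big_split /=; apply: ler_sum_nat => j /andP[j_gt0 le_jn].
rewrite -ltnS le_jn mulr1 mulrC -mulrDr ler_wpM2l ?mangoldt_ge0 // ge_q //.
by rewrite divn_gt0.
Qed.

End Psi.

(** * Stirling's bounds and the inductive step for psi *)

Section Stirling.
Variable R : realType.
Implicit Types (x y z u : R) (n m d : nat).

Lemma ln_sub_le x y : 0 < x -> 0 < y -> ln x - ln y <= x / y - 1.
Proof.
move=> x_gt0 y_gt0; rewrite -ln_div ?posrE //.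
have := @le_ln1Dx R (x / y - 1); rewrite [1 + _]addrC subrK; apply.
by rewrite ltrBrDl addrN divr_gt0.
Qed.

(** The shift c serves both 1/(z + 1) and, with c = 0, 1/z. *)
Lemma is_derive_invD (z c : R) : z + c != 0 ->
  is_derive z (1 : R) (fun u : R => (u + c)^-1) (- (z + c) ^- 2).
Proof.
move=> zc_neq0.
have dD : is_derive z (1 : R) (fun u : R => u + c) 1.
  by apply: is_derive_eq; rewrite addr0.
apply: is_derive_eq (@is_deriveV R (fun u => u + c) z 1 1 zc_neq0 dD) _.
by rewrite /GRing.scale /= mulr1.
Qed.

(** The function ln z + 4/(z + 1) has derivative (z - 1)^2 / (z (z + 1)^2) >= 0. At y = 1 + 1/x the
    bound reads 1/(x + 1/2), the lower half of [ln_step_bounds]. *)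
Lemma ln_ge_mid y : 1 <= y -> 2 * (y - 1) / (y + 1) <= ln y.
Proof.
move=> y_ge1; pose f z : R := ln z + 4 * (z + 1)^-1.
have df z : 1 <= z -> is_derive z (1 : R) f (z^-1 - 4 / (z + 1) ^+ 2).
  move=> z_ge1; have z_gt0 : 0 < z by lra.
  have z1_neq0 : z + 1 != 0 by rewrite gt_eqF //; lra.
  rewrite /f; have dln := is_derive1_ln z_gt0.
  have dV := is_derive_invD z1_neq0.
  apply: is_derive_eq; rewrite /GRing.scale /=; ring.
have : f 1 <= f y.
  apply: (@ger0_derive1_ndecry R f 1) => //.
  - by move=> z; rewrite in_itv /= andbT => /ltW /df; case.
  - move=> z; rewrite in_itv /= andbT => z_gt1.
    have dz := df z (ltW z_gt1); rewrite derive1E derive_val.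
    have -> : z^-1 - 4 / (z + 1) ^+ 2 = (z - 1) ^+ 2 / (z * (z + 1) ^+ 2).
      by field; rewrite !gt_eqF //; lra.
    by rewrite divr_ge0 ?mulr_ge0 ?sqr_ge0 //; lra.
  - apply: derivable_within_continuous => z.
    by rewrite in_itv /= andbT => /df; case.
rewrite /f ln1 add0r => le_f.
have -> : 2 * (y - 1) / (y + 1) = 2 - 4 * (y + 1)^-1.
  by field; rewrite gt_eqF //; lra.
by have : 4 * (1 + 1 : R)^-1 = 2 by [field]; lra.
Qed.

(** This is t <= sinh t at t = ln y; the difference has derivative (1 - 1/z)^2 / 2. At y = 1 + 1/x,
    multiplying by x + 1/2 gives exactly 1 + 1/(4x) - 1/(4(x + 1)). *)
Lemma ln_le_sinh y : 1 <= y -> ln y <= (y - y^-1) / 2.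
Proof.
move=> y_ge1; pose f z : R := (z - z^-1) / 2 - ln z.
have df z : 1 <= z -> is_derive z (1 : R) f ((1 + z ^- 2) / 2 - z^-1).
  move=> z_ge1; have z_gt0 : 0 < z by lra.
  have z_neq0 : z + 0 != 0 by rewrite addr0 gt_eqF.
  rewrite /f; have dln := is_derive1_ln z_gt0.
  have dV := is_derive_invD z_neq0; rewrite addr0 in dV.
  have -> : (fun z => (z - z^-1) / 2 - ln z : R) =
            (fun z => (z - (z + 0)^-1) / 2 - ln z).
    by apply/funext => u; rewrite addr0.
  apply: is_derive_eq; rewrite /GRing.scale /=; ring.
have : f 1 <= f y.
  apply: (@ger0_derive1_ndecry R f 1) => //.
  - by move=> z; rewrite in_itv /= andbT => /ltW /df; case.
  - move=> z; rewrite in_itv /= andbT => z_gt1.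
    have dz := df z (ltW z_gt1); rewrite derive1E derive_val.
    have -> : (1 + z ^- 2) / 2 - z^-1 = (1 - z^-1) ^+ 2 / 2.
      by field; rewrite gt_eqF //; lra.
    by rewrite divr_ge0 ?sqr_ge0 //; lra.
  - apply: derivable_within_continuous => z.
    by rewrite in_itv /= andbT => /df; case.
rewrite /f ln1 invr1; lra.
Qed.

Lemma ln_factS n : ln_fact R n.+1 = ln_fact R n + ln n.+1%:R.
Proof. by rewrite /ln_fact factS natrM lnM ?posrE ?ltr0n ?fact_gt0 // addrC. Qed.

Lemma ln_step_bounds n :
  1 <= (n.+1%:R + 2^-1) * (ln n.+2%:R - ln n.+1%:R : R)
    <= 1 + (4 * n.+1%:R)^-1 - (4 * n.+2%:R)^-1.
Proof.
set x : R := n.+1%:R; have x_gt0 : 0 < x by rewrite ltr0n.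
have -> : n.+2%:R = x + 1 by rewrite /x -natr1.
rewrite -ln_div ?posrE //; last lra.
have y_ge1 : 1 <= (x + 1) / x by rewrite ler_pdivlMr //; lra.
have lo := ln_ge_mid y_ge1; have hi := ln_le_sinh y_ge1.
have h0 : 0 <= x + 2^-1 by lra.
apply/andP; split.
  apply: le_trans (ler_wpM2l h0 lo).
  by rewrite le_eqVlt; apply/predU1P; left; field; rewrite !gt_eqF //; lra.
apply: le_trans (ler_wpM2l h0 hi) _.
by rewrite le_eqVlt; apply/predU1P; left; field; rewrite !gt_eqF //; lra.
Qed.

Lemma stirling n : (0 < n)%N ->
  n%:R * ln n%:R - n%:R + ln n%:R / 2 <= ln_fact R n
    <= n%:R * ln n%:R - n%:R + ln n%:R / 2 + 1.
Proof.
case: n => // n _.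
(* The difference ln n! - (n ln n - n + ln n / 2) is 1 at n = 1 and drops at each step by at most
   1/(4n) - 1/(4(n + 1)); adding 3/4 + 1/(4n) makes the lower bound inductive. *)
suff /andP[lo ->] : n.+1%:R * ln n.+1%:R - n.+1%:R + ln n.+1%:R / 2
      + 3 / 4 + (4 * n.+1%:R)^-1 <= ln_fact R n.+1
    <= n.+1%:R * ln n.+1%:R - n.+1%:R + ln n.+1%:R / 2 + 1.
  rewrite andbT (le_trans _ lo) //.
  have : 0 <= (4 * n.+1%:R)^-1 :> R by rewrite invr_ge0 mulr_ge0.
  by move: (_^-1) => c; lra.
elim: n => [|n /andP[lo hi]].
  by rewrite /ln_fact factS fact0 muln1 ln1 mulr1; apply/andP; split; lra.
have /andP[] := ln_step_bounds n.
rewrite !ln_factS; rewrite ln_factS in lo hi.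
have -> : n.+2%:R = n.+1%:R + 1 :> R by rewrite -natr1.
move: lo hi; set x : R := n.+1%:R; set F := ln_fact R n.
move: (ln x) (ln (x + 1)) ((4 * x)^-1) ((4 * (x + 1))^-1) => A B u v lo hi lo' hi'.
by apply/andP; split; lra.
Qed.

(** Convexity: x ln x - x has derivative ln x and lies above its tangents. *)
Lemma xlnx_sub_ge x y : 0 < x -> 0 < y ->
  (y - x) * ln x <= (y * ln y - y) - (x * ln x - x).
Proof.
move=> x_gt0 y_gt0; have := ln_sub_le x_gt0 y_gt0.
rewrite -(ler_pM2l y_gt0) => h.
have : y * (x / y - 1) = x - y by field; rewrite gt_eqF.
by move: h; lra.
Qed.

Lemma xlnx_le x y : 1 <= x -> x <= y -> x * ln x - x <= y * ln y - y.
Proof.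
move=> x_ge1 le_xy; rewrite -subr_ge0.
have x_gt0 : 0 < x by lra.
apply: le_trans (xlnx_sub_ge x_gt0 (lt_le_trans x_gt0 le_xy)).
by rewrite mulr_ge0 ?ln_ge0 // subr_ge0.
Qed.

(** The real quotient y = n / d lies between m = floor(y) and m + 1. Monotonicity of x ln x - x
    transfers Stirling's upper bound at m and lower bound at m + 1 to y, and (m + 1) / y <= 2 bounds
    ln(m + 1) - ln y by 1. *)
Lemma ln_fact_divn n d : (0 < d <= n)%N ->
  `|ln_fact R (n %/ d) - (n%:R / d%:R * (ln n%:R - ln d%:R) - n%:R / d%:R)|
    <= (ln n%:R - ln d%:R) / 2 + 1.
Proof.
move=> /andP[d_gt0 le_dn]; have n_gt0 := leq_trans d_gt0 le_dn.
have dR_gt0 : 0 < d%:R :> R by rewrite ltr0n.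
have nR_gt0 : 0 < n%:R :> R by rewrite ltr0n.
rewrite -ln_div ?posrE //; set y : R := n%:R / d%:R; set m := (n %/ d)%N.
have m_gt0 : (0 < m)%N by rewrite divn_gt0.
have m_ge1 : 1 <= m%:R :> R by rewrite ler1n.
have le_my : m%:R <= y by rewrite ler_pdivlMr // -natrM ler_nat leq_divM.
have le_ym : y <= m.+1%:R.
  by rewrite ler_pdivrMr // -natrM ler_nat ltnW // ltn_ceil.
have y_gt0 : 0 < y by rewrite divr_gt0.
have /andP[_ hi] := stirling m_gt0.
have /andP[lo _] := stirling (ltn0Sn m); rewrite ln_factS in lo.
have := xlnx_le m_ge1 le_my.
have := xlnx_le (le_trans m_ge1 le_my) le_ym.
have : ln m%:R <= ln y by rewrite ler_ln ?posrE //; lra.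
have := @ln_sub_le m.+1%:R y (ltr0Sn _ _) y_gt0.
have : m.+1%:R / y <= 2 by rewrite ler_pdivrMr // -natr1; lra.
by move=> *; rewrite ler_norml; apply/andP; split; lra.
Qed.

(** Stirling's formula makes the factorial terms linear in n: the parts in n ln n and n cancel
    because the weights c_d of [s] sum to 0, which leaves - n sum c_d ln d and an error. The psi
    terms fall under the induction hypothesis. *)
Lemma cheb_psi_step (q C : R) (s t : seq (nat * R)) (N0 n : nat) :
  0 < q -> 0 <= C -> (0 < N0 <= n)%N ->
  (forall m, (0 < m)%N ->
    q <= \sum_(w <- s) w.1%:R * w.2 * (m %/ w.1)%:R +
         \sum_(w <- t) w.1%:R * w.2 * (w.1 <= m)%N%:R) ->
  {in s, forall w, (0 < w.1 <= N0)%N} ->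
  {in t, forall w, (1 < w.1)%N && (0 <= w.2)} ->
  \sum_(w <- s) w.2 = 0 ->
  \sum_(w <- s) (- (w.2 * ln w.1%:R) +
      w.1%:R * `|w.2| * ((ln N0%:R - ln w.1%:R) / 2 + 1) / N0%:R) +
    \sum_(w <- t) w.2 * C <= q * C ->
  (forall m, (m < n)%N -> cheb_psi R m <= C * m%:R) ->
  cheb_psi R n <= C * n%:R.
Proof.
move=> q_gt0 C_ge0 /andP[N0_gt0 le_N0n] ge_q s_ok t_ok sum0 le_qC IHn.
have n_gt0 := leq_trans N0_gt0 le_N0n.
have nR_gt0 : 0 < n%:R :> R by rewrite ltr0n.
have N0R_gt0 : 0 < N0%:R :> R by rewrite ltr0n.
have leN0nR : N0%:R <= n%:R :> R by rewrite ler_nat.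
rewrite -(ler_pM2l q_gt0).
pose s' := [seq (w.1, w.1%:R * w.2) | w <- s].
pose t' := [seq (w.1, w.1%:R * w.2) | w <- t].
have := @cheb_psi_le_weights R q s' t' n.
rewrite !big_map !all_map /= => /(_ _ _ _)/le_trans; apply.
- by move=> m /ge_q; rewrite !big_map.
- by apply/allP => w /s_ok /andP[].
- by apply/allP => w /t_ok /andP[] /ltnW.
have -> : q * (C * n%:R) = n%:R * (q * C) by ring.
apply: le_trans (ler_wpM2l (ltW nR_gt0) le_qC); rewrite mulrDr lerD //; last first.
  rewrite mulr_sumr !big_seq; apply: ler_sum => w /t_ok /andP[w1_gt1 w2_ge0].
  have lt_wn : (n %/ w.1 < n)%N by rewrite ltn_Pdiv.
  have := IHn _ lt_wn; set p := cheb_psi R _ => le_p.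
  have le_wn : w.1%:R * (n %/ w.1)%:R <= n%:R :> R.
    by rewrite -natrM ler_nat mulnC leq_divM.
  have := ler_wpM2l C_ge0 le_wn => le_wn'.
  have w1R_ge0 : 0 <= w.1%:R :> R by [].
  have := ler_wpM2l w1R_ge0 le_p => le_p'.
  have := ler_wpM2l w2_ge0 (le_trans le_p' _); rewrite mulrCA => /(_ _ le_wn').
  by lra.
have -> : n%:R * \sum_(w <- s) (- (w.2 * ln w.1%:R) +
      w.1%:R * `|w.2| * ((ln N0%:R - ln w.1%:R) / 2 + 1) / N0%:R) =
    \sum_(w <- s) (w.2 * (n%:R * (ln n%:R - ln w.1%:R) - n%:R) +
      w.1%:R * `|w.2| * (n%:R / N0%:R * ((ln N0%:R - ln w.1%:R) / 2 + 1))).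
  apply/eqP; rewrite -subr_eq0 mulr_sumr -sumrB.
  rewrite (eq_bigr (fun w => w.2 * (n%:R - n%:R * ln n%:R))) => [|w _]; last first.
    by field; rewrite gt_eqF.
  by rewrite -mulr_suml sum0 mul0r.
rewrite !big_seq; apply: ler_sum => w /s_ok /andP[d_gt0 le_dN0].
have dR_gt0 : 0 < w.1%:R :> R by rewrite ltr0n.
have := @ln_fact_divn n w.1; rewrite d_gt0 (leq_trans le_dN0) // => /(_ isT).
set F := ln_fact R _ => err.
have le_ln : ln n%:R - ln N0%:R <= n%:R / N0%:R - 1 :> R by apply: ln_sub_le.
have le_lnd : ln w.1%:R <= ln N0%:R :> R by rewrite ler_ln ?posrE ?ler_nat.
have r_ge1 : 1 <= n%:R / N0%:R :> R by rewrite ler_pdivlMr // mul1r.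
(* The logarithmic error grows more slowly than n, so beyond N0 it is at most n / N0 times its value
   at N0. *)
have err' : (ln n%:R - ln w.1%:R) / 2 + 1 <=
    n%:R / N0%:R * ((ln N0%:R - ln w.1%:R) / 2 + 1) :> R.
  move: le_ln le_lnd r_ge1; set r : R := n%:R / N0%:R.
  set a : R := ln N0%:R; set b : R := ln w.1%:R; set c : R := ln n%:R.
  move=> le_ln le_lnd r_ge1.
  have : 0 <= (r - 1) * (a - b) by rewrite mulr_ge0 // subr_ge0.
  by lra.
have := ler_wpM2l (normr_ge0 (w.1%:R * w.2)) (le_trans err err').
rewrite -normrM => /(le_trans (ler_norm _)).
rewrite normrM (ger0_norm (ltW dR_gt0)).
set E := _ * (_ * _) => le_E; rewrite -lerBlDl; apply: le_trans le_E.
by rewrite le_eqVlt; apply/predU1P; left; field; rewrite gt_eqF.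
Qed.

End Stirling.

(** * Least common multiples up to 2 ^ 14 *)

Lemma lcm_uptoS_le n : (lcm_upto n.+1 <= lcm_upto n * n.+1)%N.
Proof. by rewrite lcm_uptoS dvdn_leq ?muln_gt0 ?lcm_upto_gt0 // dvdn_lcm dvdn_mulr ?dvdn_mull. Qed.

(** For k > 0, p^(k-1) is at most n, so it already divides [lcm_upto n] and one more factor p
    suffices. *)
Lemma lcm_uptoS_prime_power n p k : (1 < p)%N -> n.+1 = (p ^ k)%N ->
  (lcm_upto n.+1 <= lcm_upto n * p)%N.
Proof.
move=> p_gt1 def_n; have p_gt0 := ltnW p_gt1.
apply: dvdn_leq; first by rewrite muln_gt0 lcm_upto_gt0.
rewrite lcm_uptoS dvdn_lcm dvdn_mulr //=.
case: k def_n => [->|k def_n]; first exact: dvd1n.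
rewrite def_n. rewrite expnSr dvdn_mul // dvdn_lcm_upto // expn_gt0 p_gt0 /=.
by rewrite -ltnS def_n ltn_exp2l.
Qed.

(** Both factors are at most n, hence divide [lcm_upto n], and by coprimality so does their
    product. *)
Lemma lcm_uptoS_coprime n a b : (1 < a)%N -> (1 < b)%N -> coprime a b ->
  n.+1 = (a * b)%N -> lcm_upto n.+1 = lcm_upto n.
Proof.
move=> a_gt1 b_gt1 co_ab def_n; rewrite lcm_uptoS; apply/lcmn_idPl.
rewrite def_n Gauss_dvd // !dvdn_lcm_upto ?(ltnW a_gt1) ?(ltnW b_gt1) //=.
  by rewrite -ltnS def_n ltn_Pmull // ltnW.
by rewrite -ltnS def_n ltn_Pmulr // ltnW.
Qed.

Fixpoint strip_factor (fuel : nat) (p n : N) : N :=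
  if fuel is fuel'.+1 then
    let: (a, r) := N.div_eucl n p in
    if N.eqb r 0%num then strip_factor fuel' p a else n
  else n.

(* An upper bound for lcm_upto n / lcm_upto (n - 1); it is n when no prime of
   ps divides n. *)
Fixpoint lcm_ratio_bound (ps : seq N) (n : N) : N :=
  if ps is p :: ps' then
    if N.eqb (N.modulo n p) 0%num then
      (* Twenty divisions remove every factor p from a positive n below 2^20; the later test on r
         modulo p keeps the bound valid in all cases. *)
      let r := strip_factor 20%N p n in
      if N.eqb r 1%num then p else if N.eqb (N.modulo r p) 0%num then n else 1%num
    else lcm_ratio_bound ps' n
  else n.

(** Compares M^2 with 2^j for j = 3n - 2E, the first test guarding the truncated subtraction. The
    binary length of M^2 is tried first, which can avoid forming 2^j. *)
Definition lcm_check (n M E : N) : bool :=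
  if N.leb (N.mul 2%num E) (N.mul 3%num n) then
    let j := N.sub (N.mul 3%num n) (N.mul 2%num E) in
    if N.ltb (N.log2 (N.mul M M)) j then true else N.leb (N.mul M M) (N.pow 2%num j)
  else false.

(* Invariant: lcm_upto n <= M * 2 ^ E, where M is kept short by rounding up. *)
Fixpoint lcm_run (ps : seq N) (fuel : nat) (n M E : N) : bool :=
  if fuel is fuel'.+1 then
    let n' := N.succ n in
    let l := lcm_ratio_bound ps n' in
    if N.eqb l 1%num then lcm_run ps fuel' n' M E else
    let M1 := N.mul M l in
    (* The constants are 2^40 and 2^16: a rounded M keeps at least 24 bits, so each rounding costs a
       relative error of at most 2^-24. *)
    let: (M', E') := if N.ltb M1 1099511627776%num then (M1, E)
      else (N.succ (N.div M1 65536%num), N.add E 16%num) in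
    if lcm_check n' M' E' then lcm_run ps fuel' n' M' E' else false
  else true.

(** All primes below 2^7, so that a number up to 2^14 without a factor in the list is 1 or prime. *)
Definition small_primes : seq N :=
  [:: 2; 3; 5; 7; 11; 13; 17; 19; 23; 29; 31; 37; 41; 43; 47; 53; 59; 61; 67;
   71; 73; 79; 83; 89; 97; 101; 103; 107; 109; 113; 127]%num.


(** * Soundness of the computation of least common multiples *)

Lemma nat_of_mul_bin (a b : N) : N.mul a b = (a * b)%N :> nat.
Proof. by lia. Qed.

Lemma nat_of_pow_bin (a b : N) : N.pow a b = (a ^ b)%N :> nat.
Proof.
elim/N.peano_ind: b => [//|b IHb].
have -> : nat_of_bin (N.succ b) = (nat_of_bin b).+1 by lia.
by rewrite N.pow_succ_r' nat_of_mul_bin IHb expnS.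
Qed.

Lemma eqb_modulo_dvdn (p n : N) : (0 < p)%N ->
  N.eqb (N.modulo n p) 0%num = (p %| n)%N.
Proof.
move=> p_gt0; have p_neq0 : p <> 0%num by move=> p0; rewrite p0 in p_gt0.
have def_n := N.div_mod n p p_neq0.
apply/N.eqb_spec/dvdnP => [r0|[c def_cp]].
  exists (N.div n p); rewrite {1}def_n r0 N.add_0_r nat_of_mul_bin.
  exact: mulnC.
have -> : n = N.mul (bin_of_nat c) p.
  by apply: (can_inj nat_of_binK); rewrite nat_of_mul_bin bin_of_natK.
exact: N.Div0.mod_mul.
Qed.

Lemma strip_factorP fuel (p n : N) :
  exists j, nat_of_bin n = (p ^ j * strip_factor fuel p n)%N.
Proof.
elim: fuel n => [|fuel IHf] n /=; first by exists 0%N; rewrite mul1n.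
have := N.div_eucl_spec n p; case: (N.div_eucl n p) => a r def_n.
case: N.eqb_spec => [r0|_]; last by exists 0%N; rewrite mul1n.
have [j def_a] := IHf a; exists j.+1.
by rewrite def_n r0 N.add_0_r nat_of_mul_bin def_a expnS mulnA.
Qed.

Arguments strip_factor : simpl never.
Local Arguments N.div : simpl never.
Local Arguments N.mul : simpl never.
Local Arguments N.add : simpl never.

(** Let p be the first listed prime dividing n = p^j r. If r = 1, n is a prime power; if r > 1 is
    prime to p, n splits into coprime factors; otherwise the trivial factor n is used. *)
Lemma lcm_ratio_boundP (ps : seq N) (n : N) m :
  all (fun p : N => prime p) ps -> nat_of_bin n = m.+1 ->
  (lcm_upto m.+1 <= lcm_upto m * lcm_ratio_bound ps n)%N.
Proof.
move=> + def_n; elim: ps => [_|p ps IHps /= /andP[p_pr /IHps le_ps]].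
  by rewrite /= def_n lcm_uptoS_le.
have p_gt1 := prime_gt1 p_pr; have p_gt0 := ltnW p_gt1.
rewrite eqb_modulo_dvdn //; case: ifP => [p_n|//].
have [j def_nj] := strip_factorP 20 p n.
set r := strip_factor _ _ _ in def_nj *.
case: N.eqb_spec => [r1|r1].
  by apply: (@lcm_uptoS_prime_power m p j) => //; rewrite -def_n def_nj r1 muln1.
rewrite eqb_modulo_dvdn //; case: ifP => [_|pNr].
  by rewrite def_n lcm_uptoS_le.
rewrite muln1 (@lcm_uptoS_coprime m (p ^ j) r) //; last by rewrite -def_n def_nj.
- case: j def_nj => [|j _]; last by rewrite -(exp1n j.+1) ltn_exp2r.
  by rewrite mul1n => def_r; rewrite -def_r p_n in pNr.
- have : (0 < r)%N by case: (nat_of_bin r) pNr => //; rewrite dvdn0.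
  rewrite leq_eqVlt => /predU1P[r1'|//]; case: r1.
  by apply: (can_inj nat_of_binK); rewrite -r1'.
- by rewrite coprimeXl // prime_coprime // pNr.
Qed.

Lemma lcm_checkP (n M E : N) : lcm_check n M E ->
  ((M * 2 ^ E) ^ 2 <= 8 ^ n)%N.
Proof.
rewrite /lcm_check; case: ifP => // /N.leb_spec0 leE.
set j := N.sub _ _ => le_Mj.
have le_M : (M * M <= 2 ^ j)%N.
  have : N.le (N.mul M M) (N.pow 2%num j).
    move: le_Mj; case: N.ltb_spec0 => [lt_log _|_ /N.leb_spec0 //].
    case: (N.eq_0_gt_0_cases (N.mul M M)) => [->|MM_gt0]; first exact: N.le_0_l.
    exact/N.lt_le_incl/N.log2_lt_pow2.
  rewrite -nat_of_mul_bin -[2%N]/(nat_of_bin 2%num) -nat_of_pow_bin.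
  by lia.
have -> : (8 = 2 ^ 3)%N by []; rewrite -expnM.
have <- : (j + 2 * E = 3 * n)%N by rewrite /j; lia.
by rewrite expnMn -expnM (mulnC E) expnD leq_mul2r -mulnn le_M orbT.
Qed.

Lemma lcm_runP ps fuel (n M E : N) :
  all (fun p : N => prime p) ps ->
  (lcm_upto n ^ 2 <= 8 ^ n)%N -> (lcm_upto n <= M * 2 ^ E)%N ->
  lcm_run ps fuel n M E ->
  forall m, (n <= m <= n + fuel)%N -> (lcm_upto m ^ 2 <= 8 ^ m)%N.
Proof.
move=> ps_pr; elim: fuel n M E => [|fuel IHf] n M E le_n le_ME /=.
  by move=> _ m; rewrite addn0 -eqn_leq => /eqP <-.
have def_n' : nat_of_bin (N.succ n) = (nat_of_bin n).+1 by lia.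
have := lcm_ratio_boundP ps_pr def_n'; set l := lcm_ratio_bound _ _ => le_l.
move=> run m /andP[]; rewrite leq_eqVlt => /predU1P[<- _ //|lt_nm le_m].
have {}le_m : (N.succ n <= m <= N.succ n + fuel)%N.
  by rewrite def_n' lt_nm addSn -addnS.
move: run; case: N.eqb_spec => [l1|_].
  (* The least common multiple is unchanged while 8^n grows, so no test is made here. *)
  rewrite l1 muln1 in le_l => /IHf; apply => //; rewrite def_n'.
    rewrite (leq_trans (leq_trans _ le_n)) ?leq_exp2l //.
    by rewrite leq_exp2r.
  exact: leq_trans le_l le_ME.
set M1 := N.mul M l; set ME := if _ then _ else _.
have : (lcm_upto (N.succ n) <= ME.1 * 2 ^ ME.2)%N.
  have le_M1 : (lcm_upto (N.succ n) <= M1 * 2 ^ E)%N.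
    rewrite def_n' (leq_trans le_l) // nat_of_mul_bin mulnAC.
    by rewrite leq_mul2r le_ME orbT.
  rewrite /ME; set M2 := N.div _ _; case: ifP => _ //=; apply: leq_trans le_M1 _.
  have -> : nat_of_bin (N.add E 16%num) = (16 + E)%N by lia.
  rewrite expnD mulnA leq_mul2r; apply/orP; right.
  have -> : (2 ^ 16 = nat_of_bin 65536%num)%N by rewrite -[LHS]bin_of_natK.
  rewrite -nat_of_mul_bin N.mul_comm.
  have : N.lt M1 (N.mul 65536%num (N.succ M2)) by exact: N.mul_succ_div_gt.
  by move: (N.mul _ (N.succ M2)) => c; clear; lia.
case: ME => M' E' /= le_ME'; case: ifP => // /lcm_checkP le_M'E' /IHf; apply=> //.
by rewrite (leq_trans _ le_M'E') // leq_exp2r.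
Qed.

Lemma lcm_run0P ps fuel :
  all (fun p : N => prime p) ps -> lcm_run ps fuel 0%num 1%num 0%num ->
  forall n, (n <= fuel)%N -> (lcm_upto n ^ 2 <= 8 ^ n)%N.
Proof.
by move=> ps_pr /(lcm_runP ps_pr) run n le_n; apply: run; rewrite /= ?lcm_upto0.
Qed.

Lemma small_primesP : all (fun p : N => prime p) small_primes.
Proof. by vm_compute. Qed.

Lemma lcm_run_small : lcm_run small_primes (2 ^ 14)%N 0%num 1%num 0%num.
Proof. by vm_compute. Qed.

Lemma lcm_upto_sqr_small n : (n <= 2 ^ 14)%N -> (lcm_upto n ^ 2 <= 8 ^ n)%N.
Proof. exact: (lcm_run0P small_primesP lcm_run_small). Qed.

(** * Certificate for Chebyshev's method *)

Definition sumZ (T : Type) (F : T -> Z) (s : seq T) : Z :=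
  foldr (fun x acc => Z.add (F x) acc) Z0 s.

(* A countdown [(r, p, v)] adds the weight v after r + 1 ticks and then every
   p + 1 ticks. *)
Definition countdown : Type := (nat * nat * Z)%type.

Definition tick (e : countdown) : countdown :=
  let: (r, p, v) := e in if r is r'.+1 then (r', p, v) else (p, p, v).

Definition released (e : countdown) : Z :=
  let: (r, p, v) := e in if r is _.+1 then Z0 else v.

(** A countdown is p - r ticks into a period of length p + 1; this counts the periods completed
    after m more ticks. *)
Definition countdown_fires (e : countdown) (m : nat) : nat :=
  ((m + (e.1.2 - e.1.1)) %/ e.1.2.+1)%N.

(** Updating the total G tick by tick tests q <= G at every m up to the fuel without any
    division. *)
Fixpoint countdown_run (q : Z) (fuel : nat) (G : Z) (s : seq countdown) : bool :=
  if fuel is fuel'.+1 then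
    let G' := Z.add G (sumZ released s) in
    if Z.leb q G' then countdown_run q fuel' G' (map tick s) else false
  else true.

(* (d, f, k, m) stands for the term d c_d ln (n / d)! with c_d = f k; the
   fraction m / k approximates log2 d from below if f >= 0 and from above
   otherwise, so that - c_d ln d <= - f m ln 2. *)
Definition weight : Type := (nat * Z * nat * nat)%type.
Definition wt (d : nat) (f : Z) (k m : nat) : weight := (d, f, k, m).
Definition wt_coef (w : weight) : Z := let: (_, f, k, _) := w in Z.mul f (Z.of_nat k).
Definition wt_arg (w : weight) : nat := w.1.1.1.

(* (k, e) stands for the term k e psi(n / k). *)
Definition step_weight : Type := (nat * Z)%type.
Definition st (k : nat) (e : Z) : step_weight := (k, e).

Definition weight_countdown (w : weight) : countdown :=
  ((wt_arg w).-1, (wt_arg w).-1, Z.mul (Z.of_nat (wt_arg w)) (wt_coef w)).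

(** The first release is at k and the next at k + Y, so for m <= Y the count is the indicator of k
    <= m. *)
Definition step_countdown (Y : nat) (w : step_weight) : countdown :=
  (w.1.-1, Y.-1, Z.mul (Z.of_nat w.1) w.2).

(** Covers all m > Y at once: every step is then present, and [sum_mod_ge] bounds the floor sum from
    below independently of m. *)
Definition tail_check (q : Z) (Y : nat) (s : seq weight) (t : seq step_weight) : bool :=
  [&& Z.eqb (sumZ wt_coef s) Z0,
      all (fun w => 0 < wt_arg w)%N s, all (fun w => 0 < w.1 <= Y)%N t,
      all (fun w : step_weight => Z.leb Z0 w.2) t &
      Z.leb (Z.add q (sumZ (fun w => Z.mul (Z.of_nat (wt_arg w).-1)
                                       (Z.max Z0 (wt_coef w))) s))
            (sumZ (fun w : step_weight => Z.mul (Z.of_nat w.1) w.2) t)].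

Definition log_check (w : weight) : bool :=
  let: (d, f, k, m) := w in
  let x := Z.pow (Zpos 2) (Z.of_nat m) in let y := Z.pow (Z.of_nat d) (Z.of_nat k) in
  if Z.leb Z0 f then Z.leb x y else Z.leb y x.

(* In units of ln 2 / (10 * 2 ^ 14), using 1 <= 1.6 ln 2 and
   trunc_log 2 d <= log2 d: 86 = 5 * 14 + 10 * 1.6. *)
Definition weight_cost (w : weight) : Z :=
  let: (d, f, k, m) := w in
  Z.sub (Z.mul (Z.mul (Z.of_nat d) (Z.of_nat k))
               (Z.mul (Z.abs f) (Z.sub 86 (Z.mul 5 (Z.of_nat (trunc_log 2 d))))))
        (Z.mul 163840 (Z.mul f (Z.of_nat m))).

(** In the units of [weight_cost], 245760 = 15 * 2^14 stands for 3/2 ln 2. *)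
Definition cost_check (q : Z) (s : seq weight) (t : seq step_weight) : bool :=
  Z.leb (Z.add (sumZ weight_cost s) (sumZ (fun w : step_weight => Z.mul 245760 w.2) t))
        (Z.mul 245760 q).

(* The weights are a rounded optimum of the linear program that minimises the
   constant obtained for psi. *)
Definition cheb_scale : Z := 10000000.
Definition tail_start : nat := (100 * 100)%N.

Definition cheb_weights : seq weight :=
  [::
 wt 1 10000070 1 0; wt 2 (-5000000) 1 1; wt 3 (-81301) 41 65;
   wt 5 (-33898) 59 137; wt 6 31447 53 137; wt 7 (-54945) 26 73;
   wt 10 35714 28 93; wt 11 (-24570) 37 128; wt 13 (-11292) 57 211;
   wt 14 10485 57 217; wt 15 20241 32 125; wt 17 (-10320) 57 233;
   wt 19 (-124200) 4 17; wt 20 (-475) 59 255; wt 21 7968 51 224;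
   wt 22 18939 24 107; wt 23 (-16807) 21 95; wt 24 (-1913) 41 188;
   wt 26 32182 10 47; wt 28 1023 57 274; wt 29 (-3784) 57 277;
   wt 30 (-10435) 43 211; wt 31 (-2914) 22 109; wt 33 2890 23 116;
   wt 34 6361 23 117; wt 35 1505 31 159; wt 37 (-6440) 19 99;
   wt 38 1831 57 299; wt 39 3568 60 317; wt 40 501 28 149;
   wt 41 (-4602) 53 284; wt 42 (-5869) 28 151; wt 43 (-21877) 7 38;
   wt 44 (-181) 37 202; wt 45 (-5616) 2 11; wt 46 2859 44 243;
   wt 47 (-1788) 9 50; wt 51 892 58 329; wt 53 (-1113) 59 338;
   wt 55 2128 32 185; wt 56 (-181) 26 151; wt 57 1268 59 344;
   wt 58 15406 7 41; wt 59 (-1415) 60 353; wt 60 (-265) 43 254;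
   wt 61 (-177) 29 172; wt 65 729 45 271; wt 66 (-739) 45 272;
   wt 69 1231 37 226; wt 71 (-2224) 20 123; wt 74 1423 43 267;
   wt 75 (-136) 48 299; wt 77 1113 15 94; wt 78 (-15290) 7 44;
   wt 79 (-394) 23 145; wt 82 3785 14 89; wt 85 418 22 141;
   wt 86 1052 54 347; wt 87 422 52 335; wt 88 834 24 155;
   wt 90 313 59 383; wt 92 449 44 287; wt 93 2320 13 85;
   wt 94 422 56 367; wt 95 1299 58 381; wt 96 370 53 349].

(** The last step adds nearly 12 times [cheb_scale] from [tail_start] on, which pays for the crude
    bound in [tail_check] at a cost of about a thousandth of the bound on psi. *)
Definition cheb_steps : seq step_weight :=
  [::
 st 15 18948; st 21 69810; st 34 141741; st 35 239067; st 39 493;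
   st 57 90802; st 92 20; st 158 10870; st 218 19382; st 302 231;
   st 803 428; st 852 1514; st 1080 4044; st 3849 16; st 3916 1;
   st 4596 506; st 9072 44; st 9624 250; st 9676 1; st tail_start 11928].

Lemma countdown_run_cheb : countdown_run cheb_scale tail_start Z0
  (map weight_countdown cheb_weights ++ map (step_countdown tail_start) cheb_steps).
Proof. by vm_compute. Qed.

Lemma tail_check_cheb : tail_check cheb_scale tail_start cheb_weights cheb_steps.
Proof. by vm_compute. Qed.

Lemma log_check_cheb : all log_check cheb_weights.
Proof. by vm_compute. Qed.

Lemma cost_check_cheb : cost_check cheb_scale cheb_weights cheb_steps.
Proof. by vm_compute. Qed.

(** * Soundness of the Chebyshev certificate *)

Section ChebyshevCertificate.
Variable R : realType.

Definition Zr (z : Z) : R := (int_of_Z z)%:~R.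

Lemma ZrD x y : Zr (Z.add x y) = Zr x + Zr y.
Proof. by rewrite /Zr -intrD -rmorphD. Qed.

Lemma ZrM x y : Zr (Z.mul x y) = Zr x * Zr y.
Proof. by rewrite /Zr -intrM -rmorphM. Qed.

Lemma ZrB x y : Zr (Z.sub x y) = Zr x - Zr y.
Proof. by rewrite /Zr -intrB -rmorphB. Qed.

Lemma Zr_nat n : Zr (Z.of_nat n) = n%:R.
Proof. by rewrite /Zr -[Z.of_nat n]/(Z_of_int (Posz n)) Z_of_intK. Qed.

Lemma Zr0 : Zr Z0 = 0. Proof. by []. Qed.

Lemma ler_Zr x y : (Zr x <= Zr y) = Z.leb x y.
Proof. by rewrite ler_int; lia. Qed.

Lemma Zr_ge0 x : (0 <= Zr x) = Z.leb Z0 x.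
Proof. exact: ler_Zr Z0 x. Qed.

Lemma Zr_max x : Zr (Z.max Z0 x) = Num.max 0 (Zr x).
Proof.
case: (Z.leb_spec Z0 x) => [x_ge0|x_le0].
  by rewrite Z.max_r // max_r // Zr_ge0; apply/Z.leb_le.
rewrite Z.max_l ?max_l //; last exact: Z.lt_le_incl.
by rewrite -Zr0 ler_Zr; apply/Z.leb_le/Z.lt_le_incl.
Qed.

Lemma Zr_abs x : Zr (Z.abs x) = `|Zr x|.
Proof.
case: (Z.leb_spec Z0 x) => [x_ge0|/Z.lt_le_incl x_le0].
  by rewrite Z.abs_eq // ger0_norm // Zr_ge0; apply/Z.leb_le.
have le_x0 : Zr x <= 0 by rewrite -Zr0 ler_Zr; apply/Z.leb_le.
by rewrite Z.abs_neq // ler0_norm // -Z.sub_0_l ZrB Zr0 sub0r.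
Qed.

Lemma Zr_sum T (F : T -> Z) s : Zr (sumZ F s) = \sum_(x <- s) Zr (F x).
Proof. by elim: s => [|x s IHs]; rewrite ?big_nil //= big_cons ZrD IHs. Qed.

(** G plus the weights still to be released is invariant: a tick moves the released weights into G
    and leaves one tick fewer. *)
Lemma countdown_runP q fuel G (s : seq countdown) :
  all (fun e => e.1.1 <= e.1.2)%N s -> countdown_run q fuel G s ->
  forall m, (0 < m <= fuel)%N ->
    Zr q <= Zr G + \sum_(e <- s) Zr e.2 * (countdown_fires e m)%:R.
Proof.
elim: fuel G s => [|fuel IHf] G s s_ok /=.
  by move=> _ [|m].
set G' := Z.add _ _; case: ifP => // le_qG' run [//|m] /andP[_ le_m].
have s'_ok : all (fun e => e.1.1 <= e.1.2)%N (map tick s).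
  rewrite all_map; apply: sub_all s_ok => -[[[|r] p] v] //=.
  exact: ltnW.
suff -> : Zr G + \sum_(e <- s) Zr e.2 * (countdown_fires e m.+1)%:R =
    Zr G' + \sum_(e <- map tick s) Zr e.2 * (countdown_fires e m)%:R.
  case: m le_m => [|m] le_m; last by apply: (IHf G').
  rewrite big1 => [|[[r p] v] _]; last first.
    by rewrite /countdown_fires /= add0n divn_small ?mulr0 // ltnS leq_subr.
  by rewrite addr0 ler_Zr.
rewrite /G' ZrD Zr_sum big_map -addrA -big_split /=; congr (_ + _).
elim: s s_ok {run s'_ok G' le_qG'} => [|[[r p] v] s IHs] /=; first by rewrite !big_nil.
move=> /andP[le_rp /IHs {}IHs]; rewrite !big_cons IHs; congr (_ + _).
case: r le_rp => [|r] le_rp /=; rewrite /countdown_fires /=.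
  by rewrite subnn addn0 subn0 addSnnS divnDr // divnn /= natrD mulrDr mulr1 addrC.
by rewrite Zr0 add0r addSnnS -subSn.
Qed.

(** Write d floor(m / d) as m - (m mod d). The multiples of m cancel because the coefficients sum to
    0, and m mod d lies between 0 and d - 1. *)
Lemma sum_mod_ge (s : seq weight) m : sumZ wt_coef s = Z0 ->
  all (fun w => 0 < wt_arg w)%N s ->
  - \sum_(w <- s) Zr (Z.mul (Z.of_nat (wt_arg w).-1) (Z.max Z0 (wt_coef w))) <=
  \sum_(w <- s) (wt_arg w)%:R * Zr (wt_coef w) * (m %/ wt_arg w)%:R.
Proof.
move=> sum0 /allP s_gt0.
have {}sum0 : \sum_(w <- s) Zr (wt_coef w) * m%:R = 0.
  by rewrite -mulr_suml -Zr_sum sum0 Zr0 mul0r.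
rewrite -[leRHS]subr0 -[X in _ - X]sum0 -sumrB -sumrN !big_seq.
apply: ler_sum => w /s_gt0 d_gt0.
rewrite ZrM Zr_nat Zr_max; set c := Zr _; set d := wt_arg w in d_gt0 *.
have -> : m%:R = (m %/ d)%:R * d%:R + (m %% d)%:R :> R.
  by rewrite -natrM -natrD -divn_eq.
have : (m %% d <= d.-1)%N by rewrite -ltnS prednK ?ltn_mod.
rewrite -(ler_nat R); move: (_ %% _)%:R (ler0n R (m %% d)) => r.
move=> r_ge0 le_r.
have [c_ge0|c_lt0] := leP 0 c.
  have := ler_wpM2l c_ge0 le_r; lra.
have := mulr_le0_ge0 (ltW c_lt0) r_ge0; lra.
Qed.

Lemma chebyshev_weightsP q Y (s : seq weight) (t : seq step_weight) :
  tail_check q Y s t ->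
  countdown_run q Y Z0 (map weight_countdown s ++ map (step_countdown Y) t) ->
  forall m, (0 < m)%N ->
    Zr q <= \sum_(w <- s) (wt_arg w)%:R * Zr (wt_coef w) * (m %/ wt_arg w)%:R +
            \sum_(w <- t) w.1%:R * Zr w.2 * (w.1 <= m)%N%:R.
Proof.
move=> /and5P[/Z.eqb_spec sum0 s_gt0 t_gt0 t_ge0 le_tail] run m m_gt0.
have [le_mY|lt_Ym] := leqP m Y; last first.
  have := sum_mod_ge m sum0 s_gt0.
  have : Zr q + \sum_(w <- s) Zr (Z.mul (Z.of_nat (wt_arg w).-1)
      (Z.max Z0 (wt_coef w))) <= \sum_(w <- t) w.1%:R * Zr w.2 * (w.1 <= m)%N%:R.
    rewrite (eq_big_seq (fun w : step_weight => Zr (Z.mul (Z.of_nat w.1) w.2))).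
      by rewrite -!Zr_sum -ZrD ler_Zr.
    move=> w /(allP t_gt0)/andP[_ le_wY].
    by rewrite ZrM Zr_nat (leq_trans le_wY (ltnW lt_Ym)) mulr1.
  by move=> h1 h2; lra.
have s_ok : all (fun e => e.1.1 <= e.1.2)%N
    (map weight_countdown s ++ map (step_countdown Y) t).
  rewrite all_cat !all_map; apply/andP; split; first by apply/allP => w _ /=.
  apply/allP => w /(allP t_gt0)/andP[w_gt0 le_wY] /=.
  by rewrite -!subn1 leq_sub2r.
have := @countdown_runP q Y Z0 _ s_ok run m; rewrite m_gt0 le_mY => /(_ isT).
rewrite Zr0 add0r big_cat !big_map => /le_trans; apply.
rewrite le_eqVlt; apply/predU1P; left; congr (_ + _).
  apply: eq_big_seq => w /(allP s_gt0) d_gt0.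
  by rewrite /= ZrM Zr_nat /countdown_fires /= subnn addn0 prednK.
apply: eq_big_seq => -[k e] /(allP t_gt0)/andP[/= k_gt0 le_kY].
have Y_gt0 := leq_trans k_gt0 le_kY.
rewrite ZrM Zr_nat /countdown_fires /= prednK //; congr (_ * _%:R).
have -> : (Y.-1 - k.-1 = Y - k)%N by lia.
have [le_km|lt_mk] := leqP k m; last by rewrite divn_small //; lia.
have -> : (m + (Y - k) = Y + (m - k))%N by lia.
by rewrite divnDl // divnn Y_gt0 divn_small //; lia.
Qed.

(** ln 2 = ln 8 - ln 4 >= 1/5 + 1/6 + 1/7 + 1/8. This is the estimate 1 <= 1.6 ln 2 behind
    [weight_cost]. *)
Lemma ln2_ge : 5 / 8 <= ln 2 :> R.
Proof.
have ln_ge n : (0 < n)%N -> n.+1%:R^-1 <= ln n.+1%:R - ln n%:R :> R.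
  move=> n_gt0; have := @ln_sub_le R n%:R n.+1%:R.
  rewrite !ltr0n n_gt0 => /(_ isT isT).
  have -> : n%:R / n.+1%:R - 1 = - (n.+1%:R^-1) :> R.
    by rewrite -natr1; field; rewrite natr1.
  by move: (ln n%:R) (ln n.+1%:R) (n.+1%:R^-1) => a b c; lra.
have ln8 : ln 8 = ln 4 + ln 2 :> R.
  by rewrite -lnM ?posrE // -natrM.
have ln4 : ln 4 = ln 2 + ln 2 :> R.
  by rewrite -lnM ?posrE // -natrM.
have := ln_ge 4%N isT; have := ln_ge 5%N isT; have := ln_ge 6%N isT.
have := ln_ge 7%N isT; lra.
Qed.

Lemma Z_pow_nat (x : Z) n : Zr (Z.pow x (Z.of_nat n)) = Zr x ^+ n.
Proof.
elim: n => [|n IHn]; first by rewrite expr0.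
by rewrite Nat2Z.inj_succ Z.pow_succ_r ?ZrM ?IHn ?exprS //; lia.
Qed.

Lemma Zr163840 : Zr 163840 = 10 * 2 ^+ 14.
Proof.
have -> : Zr 163840 = Zr (Z.mul 10 (Z.pow 2 (Z.of_nat 14))) by [].
by rewrite ZrM Z_pow_nat.
Qed.

Lemma Zr245760 : Zr 245760 = 15 * 2 ^+ 14.
Proof.
have -> : Zr 245760 = Zr (Z.mul 15 (Z.pow 2 (Z.of_nat 14))) by [].
by rewrite ZrM Z_pow_nat.
Qed.

Lemma weight_costP N0 (w : weight) :
  N0%:R = 2 ^+ 14 :> R -> (0 < wt_arg w)%N -> log_check w ->
  - (Zr (wt_coef w) * ln (wt_arg w)%:R) +
    (wt_arg w)%:R * `|Zr (wt_coef w)| *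
      ((ln N0%:R - ln (wt_arg w)%:R) / 2 + 1) / N0%:R
  <= Zr (weight_cost w) * (ln 2 / (10 * 2 ^+ 14)).
Proof.
move=> ->; case: w => [[[d f] k] m]; rewrite /wt_arg /wt_coef /weight_cost [in X in X -> _]/=.
move=> d_gt0; rewrite [_.1.1.1]/= !(ZrM, ZrB) !Zr_nat Zr_abs.
have dR_gt0 : 0 < d%:R :> R by rewrite ltr0n.
rewrite normrM (ger0_norm (ler0n R k)).
have -> : Zr 86 = 86 by []; have -> : Zr 5 = 5 by [].
rewrite Zr163840; set F := Zr f; set e := trunc_log 2 d.
have -> : ln (2 ^+ 14) = 14 * ln 2 :> R by rewrite lnXn // mulr_natl.
have : 0 < 2 ^+ 14 :> R by rewrite exprn_gt0.
move: (2 ^+ 14) => N1 N1_gt0.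
have le_e : e%:R * ln 2 <= ln d%:R :> R.
  rewrite mulr_natl -lnXn // ler_ln ?posrE ?exprn_gt0 // -natrX ler_nat.
  exact: trunc_logP.
rewrite /log_check -!ler_Zr Zr0 !Z_pow_nat Zr_nat -/F => log_w.
have le_ln (x y : R) : 0 < x -> x <= y -> ln x <= ln y.
  by move=> x_gt0 le_xy; rewrite ler_ln ?posrE // (lt_le_trans x_gt0).
have l_ge := ln2_ge; set l : R := ln 2 in le_e l_ge *.
set L : R := ln d%:R in le_e *.
(* [log_check] puts m / k on the side of log2 d that the sign of F requires. *)
have h1 : - (F * k%:R * L) <= - (F * m%:R * l).
  have lnk : ln (d%:R ^+ k) = k%:R * L by rewrite lnXn // mulr_natl.
  have lnm : ln (Zr 2 ^+ m) = m%:R * l by rewrite lnXn // mulr_natl.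
  rewrite lerN2 -!mulrA -lnk -lnm; move: log_w.
  case: ifP => [F_ge0|/negbT]; first by move/le_ln=> le_w; rewrite ler_wpM2l ?le_w ?exprn_gt0.
  rewrite -ltNge => /ltW F_le0 /le_ln le_w.
  by rewrite ler_wnM2l ?le_w ?exprn_gt0.
have h2 : (14 * l - L) / 2 + 1 <= (86 - 5 * e%:R) / 10 * l by lra.
have c_ge0 : 0 <= d%:R * (`|F| * k%:R) / N1.
  by rewrite !mulr_ge0 // invr_ge0 ltW.
have := lerD h1 (ler_wpM2l c_ge0 h2); move: `|F| => aF.
rewrite [in X in X -> _](mulrAC _ N1^-1) => /le_trans; apply.
by rewrite le_eqVlt; apply/predU1P; left; field; rewrite gt_eqF.
Qed.

Lemma cost_checkP N0 q (s : seq weight) (t : seq step_weight) :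
  N0%:R = 2 ^+ 14 :> R ->
  cost_check q s t -> all (fun w => 0 < wt_arg w)%N s ->
  all log_check s ->
  \sum_(w <- s) (- (Zr (wt_coef w) * ln (wt_arg w)%:R) +
      (wt_arg w)%:R * `|Zr (wt_coef w)| *
      ((ln N0%:R - ln (wt_arg w)%:R) / 2 + 1) / N0%:R) +
    \sum_(w <- t) Zr w.2 * (3 / 2 * ln 2) <= Zr q * (3 / 2 * ln 2).
Proof.
move=> def_N0 cost /allP s_arg /allP s_log.
have T_neq0 : 2 ^+ 14 != 0 :> R by rewrite expf_neq0.
have l_ge0 : 0 <= ln 2 / (10 * 2 ^+ 14) :> R.
  by rewrite divr_ge0 ?mulr_ge0 ?exprn_ge0 // ln_ge0 // ler1n.
have le_s : \sum_(w <- s) (- (Zr (wt_coef w) * ln (wt_arg w)%:R) +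
      (wt_arg w)%:R * `|Zr (wt_coef w)| *
      ((ln N0%:R - ln (wt_arg w)%:R) / 2 + 1) / N0%:R) <=
    Zr (sumZ weight_cost s) * (ln 2 / (10 * 2 ^+ 14)).
  rewrite Zr_sum mulr_suml !big_seq; apply: ler_sum => w w_s.
  exact: weight_costP def_N0 (s_arg _ w_s) (s_log _ w_s).
have def_t : \sum_(w <- t) Zr w.2 * (3 / 2 * ln 2) =
    Zr (sumZ (fun w : step_weight => Z.mul 245760 w.2) t) * (ln 2 / (10 * 2 ^+ 14)).
  rewrite Zr_sum mulr_suml; apply: eq_bigr => w _; rewrite ZrM Zr245760.
  by move: (2 ^+ 14) T_neq0 => T T_neq0; field.
apply: le_trans (lerD le_s (lexx _)) _; rewrite def_t -mulrDl -ZrD.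
have -> : Zr q * (3 / 2 * ln 2) = Zr (Z.mul 245760 q) * (ln 2 / (10 * 2 ^+ 14)).
  rewrite ZrM Zr245760.
  by move: (2 ^+ 14) T_neq0 => T T_neq0; field.
by rewrite ler_wpM2r // ler_Zr.
Qed.

(** Strong induction: the computation covers n <= 2^14 and the certificate feeds [cheb_psi_step]
    beyond. The constant 3/2 ln 2 is the one that turns into d_N <= 8^(N/2). *)
Lemma cheb_psi_le_ln2 n : cheb_psi R n <= 3 / 2 * ln 2 * n%:R.
Proof.
(* Naming the threshold keeps the unary numeral 2 ^ 14 from being computed. *)
have [N0 def_N0] : exists N0, N0 = (2 ^ 14)%N by exists (2 ^ 14)%N.
have N0_gt0 : (0 < N0)%N by rewrite def_N0 expn_gt0.
have N0R : N0%:R = 2 ^+ 14 :> R by rewrite def_N0 natrX.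
have lt_N0 : (96 <= N0)%N.
  by rewrite def_N0 (@leq_trans (2 ^ 7)) // leq_exp2l.
elim/ltn_ind: n => n IHn; have [le_n|lt_n] := leqP n N0.
  rewrite def_N0 in le_n; have le_sqr := lcm_upto_sqr_small le_n.
  have d_gt0 : 0 < (lcm_upto n)%:R :> R by rewrite ltr0n lcm_upto_gt0.
  have : ln ((lcm_upto n)%:R ^+ 2) <= ln (2 ^+ 3 ^+ n) :> R.
    by rewrite ler_ln ?posrE ?exprn_gt0 // -!natrX ler_nat.
  rewrite -exprM !lnXn // -/(cheb_psi R n).
  by rewrite -[ln 2 *+ _]mulr_natl natrM; lra.
have s_le96 : all (fun w => wt_arg w <= 96)%N cheb_weights by vm_compute.
have t_arg : all (fun w : step_weight => 1 < w.1)%N cheb_steps by vm_compute.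
have /and5P[sum0 s_gt0 _ /allP t_ge0 _] := tail_check_cheb.
pose s := [seq (wt_arg w, Zr (wt_coef w)) | w <- cheb_weights].
pose t := [seq (w.1, Zr w.2) | w <- cheb_steps].
apply: (@cheb_psi_step R (Zr cheb_scale) _ s t N0).
- by rewrite -Zr0 ltNge ler_Zr.
- by rewrite !mulr_ge0 // ln_ge0 // ler1n.
- by rewrite N0_gt0 ltnW.
- move=> m m_gt0; rewrite /s /t !big_map.
  exact: chebyshev_weightsP tail_check_cheb countdown_run_cheb m m_gt0.
- move=> _ /mapP[w w_s ->] /=; rewrite (allP s_gt0 w w_s).
  exact: leq_trans (allP s_le96 w w_s) lt_N0.
- move=> _ /mapP[w w_t ->] /=; rewrite (allP t_arg w w_t) Zr_ge0.
  exact: t_ge0.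
- by rewrite /s big_map -Zr_sum (Z.eqb_spec _ _ sum0).
- rewrite /s /t !big_map.
  exact: cost_checkP N0R cost_check_cheb s_gt0 log_check_cheb.
- exact: IHn.
Qed.

End ChebyshevCertificate.

(** * Euler's constant and alternating tails *)

Section EulerGamma.
Variable R : realType.
Implicit Types (n m a k : nat).

Local Notation H := (series (@harmonic R)).

Definition gamma_seq n : R := H n - ln n%:R.

Lemma harmonicS n : H n.+1 = H n + n.+1%:R^-1.
Proof. by rewrite /series /= big_nat_recr. Qed.

Lemma ln_le_harmonic n : ln n.+1%:R <= H n.
Proof.
elim: n => [|n IHn]; first by rewrite ln1 /series /= big_geq.
rewrite harmonicS; have := @ln_sub_le R n.+2%:R n.+1%:R (ltr0Sn _ _) (ltr0Sn _ _).
have -> : n.+2%:R / n.+1%:R - 1 = n.+1%:R^-1 :> R.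
  rewrite -[n.+2%:R]natr1; have : n.+1%:R != 0 :> R by rewrite pnatr_eq0.
  by move: (n.+1%:R) => x x_neq0; field.
by move: (ln _) (ln _) IHn (_^-1) => x y IHn z; lra.
Qed.

Lemma gamma_seq_decr n : gamma_seq n.+2 <= gamma_seq n.+1.
Proof.
rewrite /gamma_seq harmonicS.
have := @ln_sub_le R n.+1%:R n.+2%:R (ltr0Sn _ _) (ltr0Sn _ _).
have -> : n.+1%:R / n.+2%:R - 1 = - (n.+2%:R^-1) :> R.
  rewrite -[n.+1%:R](addrK 1) natr1; have : n.+2%:R != 0 :> R by rewrite pnatr_eq0.
  by move: (n.+2%:R) => x x_neq0; field.
by move: (ln _) (ln _) (_^-1) => x y z; lra.
Qed.

Lemma cvg_gamma_seq : gamma_seq @ \oo --> euler_gamma R.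
Proof.
suff : cvgn gamma_seq by [].
(* Monotonicity starts at index 1, the value at 0 involving the default ln 0 = 0. *)
have : cvgn [sequence gamma_seq n.+1]_n.
  apply: nonincreasing_is_cvgn.
    by apply/nonincreasing_seqP => n; apply: gamma_seq_decr.
  exists 0 => _ [n _ <-]; rewrite subr_ge0.
  by apply: le_trans (ln_le_harmonic _) _; rewrite harmonicS lerDl invr_ge0.
by move=> cvgS; apply/cvg_ex; exists (limn [sequence gamma_seq n.+1]_n); rewrite -cvg_shiftS.
Qed.

Lemma cvg_double : (fun n => n.*2) @ \oo --> \oo.
Proof. by under eq_fun do rewrite -mul2n; apply: cvg_mulnl. Qed.

Lemma cvg_half : half @ \oo --> \oo.
Proof. by have := @cvg_divnr 2 isT; under eq_fun do rewrite divn2. Qed.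

Lemma cvg_expn_add n : (fun M => 2 ^ (n + M))%N @ \oo --> \oo.
Proof.
apply/cvgnyPge => A; exists A => // M /= le_AM.
apply: leq_trans le_AM (leq_trans (leq_addl n M) _).
exact/ltnW/ltn_expl.
Qed.

(* [alt_tail a] is the alternating tail 1/a - 1/(a+1) + 1/(a+2) - ... for
   0 < a; at a = 1 this is ln 2.  The value at 0 is junk, chosen so that
   [alt_tailS] holds with 0^-1 = 0. *)
Fixpoint alt_tail a : R := if a is a'.+1 then a'%:R^-1 - alt_tail a' else - ln 2.

Lemma alt_tailS a : alt_tail a + alt_tail a.+1 = a%:R^-1.
Proof. by rewrite /= addrC subrK. Qed.

(** The first 2a terms of 1 - 1/2 + 1/3 - ... sum to H_(2a) - H_a. *)
Lemma alt_tail_odd a : alt_tail a.*2.+1 = ln 2 - (H a.*2 - H a).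
Proof.
elim: a => [|a IHa]; first by rewrite /= invr0 sub0r opprK subrr subr0.
have := alt_tailS a.*2.+1; have := alt_tailS a.*2.+2.
rewrite doubleS [H a.*2.+2]harmonicS [H a.*2.+1]harmonicS [H a.+1]harmonicS.
have -> : a.+1%:R^-1 = 2 * a.*2.+2%:R^-1 :> R.
  by rewrite -doubleS -muln2 natrM invfM mulrCA divff ?mulr1 ?pnatr_eq0.
rewrite IHa; move: (alt_tail a.*2.+2) (alt_tail a.*2.+3) => y z.
by move: (a.*2.+1%:R^-1) (a.*2.+2%:R^-1) => u v; lra.
Qed.

Lemma alt_tail_double a : alt_tail a.*2 = a.*2%:R^-1 - (ln 2 - (H a.*2 - H a)).
Proof. by rewrite -alt_tail_odd -(alt_tailS a.*2) addrK. Qed.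

Lemma harmonic_double a : (0 < a)%N ->
  H a.*2 - H a = gamma_seq a.*2 - gamma_seq a + ln 2.
Proof.
move=> a_gt0; rewrite /gamma_seq -muln2 natrM lnM ?posrE ?ltr0n //; lra.
Qed.

(** By [harmonic_double] the tails at 2a and 2a + 1 are, up to sign and a reciprocal, differences of
    two terms of [gamma_seq]. This ties the recursive definition to the true tails. *)
Lemma cvg_alt_tail : alt_tail @ \oo --> (0 : R).
Proof.
pose e a : R := `|gamma_seq a./2 - gamma_seq a./2.*2| + a%:R^-1.
have cvg_e : e @ \oo --> (0 : R).
  have cvg_inv : (fun a => a%:R^-1 : R) @ \oo --> (0 : R).
    by rewrite -cvg_shiftS; apply: cvg_harmonic.
  rewrite -[0 in X in _ --> X](addr0 (0 : R)); apply: cvgD => //.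
  rewrite -(normr0 R) -(subrr (euler_gamma R)); apply: cvg_norm; apply: cvgB.
    exact: (cvg_comp _ _ cvg_half cvg_gamma_seq).
  exact: (cvg_comp _ _ cvg_half (cvg_comp _ _ cvg_double cvg_gamma_seq)).
apply: norm_cvg0; apply: squeeze_cvgr (cvg_cst 0) cvg_e.
exists 2%N => // a /= a_ge2; rewrite normr_ge0 /= /e.
have h_gt0 : (0 < a./2)%N by rewrite half_gt0.
rewrite -{1}(odd_double_half a); have := harmonic_double h_gt0.
have a_ge0 : 0 <= a%:R^-1 :> R by [].
case: (boolP (odd a)) => odd_a def_H; rewrite ?(add1n, add0n).
  rewrite alt_tail_odd def_H.
  have -> : ln 2 - (gamma_seq a./2.*2 - gamma_seq a./2 + ln 2) =
      gamma_seq a./2 - gamma_seq a./2.*2 by lra.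
  by rewrite lerDl.
rewrite alt_tail_double def_H.
have -> : a./2.*2 = a by rewrite -[RHS]odd_double_half (negPf odd_a).
apply: le_trans (ler_normD _ _) _; rewrite (ger0_norm a_ge0) addrC lerD2r normrN.
by rewrite le_eqVlt; apply/predU1P; left; congr `|_|; lra.
Qed.

(** For a > 0, the integral of x^(a-1) (1-x)^m / (1+x) over [0, 1]: each difference contributes a
    factor 1 - x. *)
Fixpoint alt_diff m a : R :=
  if m is m'.+1 then alt_diff m' a - alt_diff m' a.+1 else alt_tail a.

(* [beta_val m a.+1] is the beta integral of x^a (1-x)^m over [0, 1]. *)
Definition beta_val m a : R := (m`! * a.-1`!)%:R / ((a + m)`!)%:R.

(** For the integrands: x^(a-1) (1-x)^m - x^a (1-x)^m = x^(a-1) (1-x)^(m+1). *)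
Lemma beta_valS m a : (0 < a)%N ->
  beta_val m a - beta_val m a.+1 = beta_val m.+1 a.
Proof.
case: a => // a _; rewrite /beta_val -[a.+1.-1]/a -[a.+2.-1]/a.+1 addnS !addSn.
rewrite [(a + m).+2`!]factS [a.+1`!]factS [m.+1`!]factS.
move: ((a + m).+1`!) (fact_gt0 (a + m).+1) (a`!) (m`!) => z z_gt0 u v.
have z_neq0 : z%:R != 0 :> R by rewrite pnatr_eq0 -lt0n.
have : (a + m).+2%:R != 0 :> R by rewrite pnatr_eq0.
rewrite !natrM.
have -> : (a + m).+2%:R = a.+1%:R + m.+1%:R :> R by rewrite -natrD addnS addSn.
move: (a.+1%:R) (m.+1%:R) => x y xy_neq0.
by field; rewrite z_neq0 xy_neq0.
Qed.

Lemma beta_val_ge0 m a : 0 <= beta_val m a.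
Proof. by rewrite divr_ge0. Qed.

Lemma beta_val_homo m a b : (0 < a <= b)%N -> beta_val m b <= beta_val m a.
Proof.
move=> /andP[a_gt0]; elim: b => [|b IHb]; first by case: a a_gt0.
rewrite leq_eqVlt => /predU1P[-> //|]; rewrite ltnS => le_ab.
apply: le_trans (IHb le_ab); rewrite -subr_ge0 beta_valS ?beta_val_ge0 //.
exact: leq_trans le_ab.
Qed.

(** Adding the integrands at a and a + 1 produces a factor 1 + x, which cancels the denominator. *)
Lemma alt_diffS m a : (0 < a)%N -> alt_diff m a + alt_diff m a.+1 = beta_val m a.
Proof.
elim: m a => [|m IHm] a a_gt0.
  rewrite alt_tailS /beta_val addn0 fact0 mul1n.
  case: a a_gt0 => // a _; by rewrite factS natrM invfM mulrCA divff ?mulr1 //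
    pnatr_eq0 -lt0n fact_gt0.
by rewrite -beta_valS // -!IHm //=; lra.
Qed.

Lemma cvg_alt_diff m : alt_diff m @ \oo --> (0 : R).
Proof.
elim: m => [|m IHm] /=; first exact: cvg_alt_tail.
rewrite -[0 in X in _ --> X](subrr (0 : R)); apply: cvgB => //.
by rewrite -cvg_shiftS in IHm.
Qed.

(** Positivity without integrals: by [alt_diffS] the value drops from b to b + 2 by a difference of
    beta values, which is nonnegative, and along such steps it tends to 0. *)
Lemma alt_diff_ge0 m a : (0 < a)%N -> 0 <= alt_diff m a.
Proof.
move=> a_gt0; have step b : (0 < b)%N -> alt_diff m b.+2 <= alt_diff m b.
  move=> b_gt0; have := alt_diffS m b_gt0; have := alt_diffS m (ltn0Sn b).
  have := beta_val_homo m (a := b) (b := b.+1); rewrite b_gt0 leqnSn => /(_ isT).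
  by move=> h1 h2 h3; lra.
have le_iter i : alt_diff m (a + i.*2) <= alt_diff m a.
  elim: i => [|i IHi]; first by rewrite addn0.
  apply: le_trans IHi; rewrite doubleS !addnS; apply: step.
  by rewrite addn_gt0 a_gt0.
have cvg_a : (fun i => alt_diff m (a + i.*2)) @ \oo --> (0 : R).
  apply: cvg_comp (cvg_alt_diff m).
  exact: (cvg_comp _ _ cvg_double (cvg_addnl a)).
have := @limr_le _ \oo _ R (alt_diff m a) _ (cvgP _ cvg_a).
rewrite (cvg_lim _ cvg_a) //; apply; near=> i; exact: le_iter.
Unshelve. all: by end_near.
Qed.

Lemma alt_diff_le_beta m a : (0 < a)%N -> alt_diff m a <= beta_val m a.
Proof. by move=> a_gt0; rewrite -alt_diffS // lerDl alt_diff_ge0. Qed.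

Lemma alt_diff_sum m a :
  alt_diff m a = \sum_(0 <= j < m.+1) 'C(m, j)%:R * ((-1) ^+ j * alt_tail (a + j)).
Proof.
elim: m a => [|m IHm] a; first by rewrite big_nat1 bin0 !mul1r addn0.
rewrite /= big_nat_recl //.
under eq_bigr do rewrite binS natrD mulrDl.
rewrite big_split /= addrA; congr (_ + _); last first.
  rewrite IHm -sumrN; apply: eq_bigr => j _.
  by rewrite addSnnS exprS mulN1r mulNr mulrN.
transitivity (\sum_(0 <= j < m.+2)
    'C(m, j)%:R * ((-1) ^+ j * alt_tail (a + j))).
  by rewrite IHm [RHS]big_nat_recr //= bin_small // mul0r addr0.
by rewrite [LHS]big_nat_recl // !bin0.
Qed.

Lemma alt_tail_shift a j :
  (-1) ^+ j * alt_tail (a + j) =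
  alt_tail a - \sum_(0 <= k < j) (-1) ^+ k / (a + k)%:R.
Proof.
elim: j => [|j IHj]; first by rewrite big_geq // mul1r addn0 subr0.
rewrite big_nat_recr //= opprD addrA -IHj -alt_tailS addnS exprS; ring.
Qed.

(** Each signed shifted tail is T(a) minus a partial sum, and the binomial coefficients in front of
    T(a) add up to 2^m. *)
Lemma alt_diff_expand m a :
  alt_diff m a = 2 ^+ m * alt_tail a -
    \sum_(0 <= j < m.+1) 'C(m, j)%:R * \sum_(0 <= k < j) (-1) ^+ k / (a + k)%:R.
Proof.
rewrite alt_diff_sum; under eq_bigr do rewrite alt_tail_shift mulrBr.
rewrite sumrB -mulr_suml -natr_sum; congr (_ * _ - _).
rewrite -natrX -[2%N]/(1 + 1)%N expnDn big_mkord; congr (_%:R).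
by apply: eq_bigr => i _; rewrite !exp1n !muln1.
Qed.

End EulerGamma.

(** * The 2-logarithm *)

Section QLog.
Variable R : realType.
Implicit Types (z : R) (n m a k M : nat).

Definition qln_term z (i : nat) : R := (-1) ^+ i * z ^+ i.+1 / (2 ^+ i.+1 - 1).

Definition qln1D z : R := limn (series (qln_term z)).

Lemma qln1DE z : qln 2 (1 + z) = qln1D z.
Proof. by rewrite /qln /qln1D /qln_term addrAC subrr add0r. Qed.

Lemma pow2_ge2 i : 2 <= 2 ^+ i.+1 :> R.
Proof. by rewrite -natrX ler_nat -{1}(expn1 2) leq_exp2l. Qed.

Lemma qln_term_le z i : 0 <= z -> `|qln_term z i| <= geometric z z i.
Proof.
move=> z_ge0; have := pow2_ge2 i => ge2.
rewrite /geometric /= -exprS /qln_term !normrM normrX normrN normr1 expr1n mul1r.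
rewrite (ger0_norm (exprn_ge0 _ z_ge0)) normfV ger0_norm; last lra.
by rewrite ler_piMr ?exprn_ge0 // invf_le1; lra.
Qed.

Lemma cvg_normed_qln z : 0 <= z < 1 -> cvgn [normed series (qln_term z)].
Proof.
move=> /andP[z_ge0 z_lt1].
apply: (@series_le_cvg R _ (geometric z z)) => [i|i|i|].
- exact: normr_ge0.
- by rewrite /geometric /= mulr_ge0 ?exprn_ge0.
- exact: qln_term_le.
- by apply: is_cvg_geometric_series; rewrite ger0_norm.
Qed.

Lemma cvg_series_qln z : 0 <= z < 1 -> cvgn (series (qln_term z)).
Proof. by move=> z01; apply: normed_cvg; apply: cvg_normed_qln. Qed.

Lemma qln1D_le z : 0 <= z < 1 -> `|qln1D z| <= z / (1 - z).
Proof.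
move=> z01; have /andP[z_ge0 z_lt1] := z01.
have nz_lt1 : `|z| < 1 by rewrite ger0_norm.
apply: le_trans (lim_series_norm (cvg_normed_qln z01)) _.
rewrite -(cvg_lim _ (@cvg_geometric_series _ z z nz_lt1)) //.
apply: lim_series_le => [||i]; first exact: cvg_normed_qln.
  exact: is_cvg_geometric_series.
exact: qln_term_le.
Qed.

(** Subtracting the series at z / 2 multiplies each coefficient by 2^mu - 1 over 2^mu, which cancels
    the denominator and leaves a geometric series of ratio - z / 2. *)
Lemma qln1D_half z : 0 <= z < 1 -> qln1D z = z / (2 + z) + qln1D (z / 2).
Proof.
move=> z01; have /andP[z_ge0 z_lt1] := z01.
have h01 : 0 <= z / 2 < 1 by apply/andP; split; lra.
apply/eqP; rewrite -subr_eq /qln1D; apply/eqP.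
rewrite -lim_seriesB; [|exact: cvg_series_qln..].
have -> : qln_term z - qln_term (z / 2) = geometric (z / 2) (- (z / 2)).
  apply/funext => i; rewrite /geometric /= /qln_term.
  transitivity (qln_term z i - qln_term (z / 2) i); first by [].
  have := pow2_ge2 i; rewrite /qln_term; set p : R := 2 ^+ i.+1 => p_ge2.
  have -> : z ^+ i.+1 = p * (z / 2) ^+ i.+1.
    by rewrite -exprMn; congr (_ ^+ _); field.
  rewrite [(- (z / 2)) ^+ i]exprNn [in RHS]mulrCA -exprS; field.
  by rewrite gt_eqF //; lra.
have w_lt1 : `|- (z / 2)| < 1 by rewrite normrN ger0_norm; lra.
rewrite (cvg_lim _ (@cvg_geometric_series _ (z / 2) _ w_lt1)) //.
by field; rewrite !gt_eqF //; lra.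
Qed.

Lemma qln1D_iter z M : 0 <= z < 1 ->
  \sum_(0 <= i < M) z / (2 ^+ i.+1 + z) = qln1D z - qln1D (z / 2 ^+ M).
Proof.
move=> z01; have /andP[z_ge0 z_lt1] := z01.
elim: M => [|M IHM]; first by rewrite big_geq // expr0 divr1 subrr.
rewrite big_nat_recr //= IHM; have p_ge1 : 1 <= 2 ^+ M :> R.
  by rewrite exprn_ege1 // ler1n.
have p_gt0 : 0 < 2 ^+ M :> R by lra.
rewrite (@qln1D_half (z / 2 ^+ M)); last first.
  rewrite divr_ge0 // 1?ltW //= ltr_pdivrMr // mul1r; lra.
rewrite !exprS; set x := qln1D z; set p := 2 ^+ M in p_ge1 p_gt0 *.
have -> : z / (2 * p) = z / p / 2 by field; rewrite gt_eqF.
have -> : z / p / (2 + z / p) = z / (2 * p + z).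
  by field; rewrite !gt_eqF //; nra.
by ring.
Qed.

Lemma cvg_inv_pow2 n : (fun M => (2 ^+ (n + M))^-1) @ \oo --> (0 : R).
Proof.
have -> : (fun M => (2 ^+ (n + M))^-1 : R) = geometric (2 ^+ n)^-1 2^-1.
  by apply/funext => M; rewrite /geometric /= exprD invfM exprVn.
by apply: cvg_geometric; rewrite ger0_norm //; lra.
Qed.

Lemma cvg_qln1D n k : (k < 2 ^ n)%N ->
  (fun M => qln1D (k%:R / 2 ^+ (n + M))) @ \oo --> (0 : R).
Proof.
move=> lt_k; apply: norm_cvg0.
have cvg_u : (fun M => 2 * k%:R * (2 ^+ (n + M))^-1) @ \oo --> (0 : R).
  rewrite -[X in _ --> X](mulr0 (2 * k%:R : R)).
  by apply: cvgM; [exact: cvg_cst|exact: cvg_inv_pow2].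
(* From M = 1 on, z = k / 2^(n + M) is at most 1/2, so z / (1 - z) <= 2 z. *)
apply: squeeze_cvgr (cvg_cst 0) cvg_u; exists 1%N => // M /= M_gt0.
rewrite normr_ge0 /=.
have p_gt0 : 0 < 2 ^+ (n + M) :> R by rewrite exprn_gt0.
set z := k%:R / _; have z_ge0 : 0 <= z by rewrite divr_ge0 // ltW.
have z_le : z <= 2^-1.
  rewrite ler_pdivrMr // -ler_pdivrMl ?invr_gt0 // invrK -natrX -natrM ler_nat.
  apply: leq_trans (_ : 2 * 2 ^ n <= _)%N; first by rewrite leq_mul2l ltnW.
  by rewrite -expnS leq_exp2l // -addn1 leq_add2l.
have z01 : 0 <= z < 1 by rewrite z_ge0; lra.
apply: le_trans (qln1D_le z01) _; rewrite -mulrA -/z ler_pdivrMr; last lra.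
have : 0 <= z * (1 - 2 * z) by rewrite mulr_ge0 //; lra.
by lra.
Qed.

(* The sum of 1 / (2 ^ v + k) over v > n. *)
Definition inv_sum n k : R :=
  if k is 0 then (2 ^+ n)^-1 else qln1D (k%:R / 2 ^+ n) / k%:R.

(** For k > 0 put z = k / 2^n < 1; each summand is z / (2^(i+1) + z) divided by k, so [qln1D_iter]
    applies. For k = 0 the sum is geometric. *)
Lemma cvg_sum_inv n k : (k < 2 ^ n)%N ->
  (fun M => \sum_(0 <= i < M) (2 ^ (n + i.+1) + k)%:R^-1) @ \oo -->
    inv_sum n k.
Proof.
case: k => [_|k lt_k].
  have -> : (fun M => \sum_(0 <= i < M) (2 ^ (n + i.+1) + 0)%:R^-1) =
      (fun M => (2 ^+ n)^-1 - (2 ^+ (n + M))^-1) :> (nat -> R).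
    apply/funext; elim=> [|M IHM]; first by rewrite big_geq // addn0 subrr.
    rewrite big_nat_recr //= IHM addn0 natrX addnS exprS; field.
    by rewrite !expf_neq0.
  rewrite -[X in _ --> X]subr0; apply: cvgB; first exact: cvg_cst.
  exact: cvg_inv_pow2.
have p_gt0 : 0 < 2 ^+ n :> R by rewrite exprn_gt0.
have z01 : 0 <= (k.+1%:R / 2 ^+ n : R) < 1.
  by rewrite divr_ge0 ?(ltW p_gt0) //= ltr_pdivrMr // mul1r -natrX ltr_nat.
have -> : (fun M => \sum_(0 <= i < M) (2 ^ (n + i.+1) + k.+1)%:R^-1) =
    (fun M => (qln1D (k.+1%:R / 2 ^+ n) - qln1D (k.+1%:R / 2 ^+ (n + M))) *
       k.+1%:R^-1) :> (nat -> R).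
  apply/funext => M; rewrite exprD invfM mulrA -qln1D_iter // mulr_suml.
  apply: eq_bigr => i _; rewrite natrD natrX exprD.
  have : 2 ^+ n * 2 ^+ i.+1 + k.+1%:R != 0 :> R.
    by rewrite -!natrX -natrM -natrD pnatr_eq0 addnS.
  have : 2 ^+ n != 0 :> R by rewrite gt_eqF.
  have : k.+1%:R != 0 :> R by rewrite pnatr_eq0.
  move: (2 ^+ n) (2 ^+ i.+1) (k.+1%:R) => x y z z_neq0 x_neq0 xyz_neq0.
  by field; rewrite z_neq0 x_neq0 mulrC xyz_neq0.
apply: cvgM; last exact: cvg_cst.
rewrite -[X in _ --> X]subr0; apply: cvgB; first exact: cvg_cst.
exact: cvg_qln1D.
Qed.

Lemma cvg_sum_nat a b (f : nat -> nat -> R) (l : nat -> R) :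
  (forall i, (a <= i < b)%N -> f i @ \oo --> l i) ->
  (fun M => \sum_(a <= i < b) f i M) @ \oo --> \sum_(a <= i < b) l i.
Proof.
elim: b => [|b IHb] cvg_f.
  by under eq_fun do rewrite big_geq //; rewrite big_geq //; apply: cvg_cst.
have [le_ab|lt_ba] := leqP a b; last first.
  by under eq_fun do rewrite big_geq //; rewrite big_geq //; apply: cvg_cst.
under eq_fun do rewrite big_nat_recr //=; rewrite big_nat_recr //=.
apply: cvgD; last by apply: cvg_f; rewrite le_ab ltnSn.
by apply: IHb => i /andP[le_ai lt_ib]; apply: cvg_f; rewrite le_ai ltnW.
Qed.

End QLog.

(** * The linear form in gamma *)

Section Main.
Variable R : realType.
Implicit Types (n m a k j M : nat).

Local Notation H := (series (@harmonic R)).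

(** T(2a) - 1/(2a) is the difference of [gamma_seq] at 2a and a, so the sum over powers of 2
    telescopes; the lower boundary term is H - n ln 2. *)
Lemma sum_alt_tail_pow2 n M :
  \sum_(0 <= i < M) alt_tail R (2 ^ (n + i.+1)) =
  gamma_seq R (2 ^ (n + M)) - H (2 ^ n)%N + n%:R * ln 2 +
    ((2 ^+ n)^-1 - (2 ^+ (n + M))^-1).
Proof.
elim: M => [|M IHM].
  rewrite big_geq // addn0 /gamma_seq natrX lnXn // -mulr_natl; ring.
rewrite big_nat_recr //= IHM addnS expnS mul2n alt_tail_double.
have /harmonic_double -> : (0 < 2 ^ (n + M))%N by rewrite expn_gt0.
rewrite -mul2n natrM natrX exprS.
have : 2 ^+ (n + M) != 0 :> R by rewrite expf_neq0.
by move: (2 ^+ (n + M)) => x x_neq0; field; rewrite x_neq0 expf_neq0.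
Qed.

(* The integral of (1 - x)^m / (1 + x) * sum_(v > n) x^(2^v - 1) over [0, 1]. *)
Definition remainder n m : R :=
  qlog_form R n m + 2 ^+ m * euler_gamma R - 2 ^+ m * H (2 ^ n)%N + (2 ^+ n)^-1.

Lemma inv_sum_alt n j :
  \sum_(0 <= k < j) (-1) ^+ k * inv_sum R n k =
  (0 < j)%N%:R * (2 ^+ n)^-1 -
  \sum_(1 <= k < j) (-1) ^+ k.-1 / k%:R * qln 2 (1 + k%:R / 2 ^+ n).
Proof.
case: j => [|j]; first by rewrite !big_geq // mul0r subrr.
rewrite big_ltn // expr0; congr (_ + _); rewrite -sumrN.
apply: eq_big_nat => -[//|k] _; rewrite qln1DE exprS /=; ring.
Qed.

Lemma remainderE n m : (0 < m)%N ->
  remainder n m =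
  2 ^+ m * (euler_gamma R - H (2 ^ n)%N + n%:R * ln 2 + (2 ^+ n)^-1) -
  \sum_(0 <= j < m.+1) 'C(m, j)%:R *
    \sum_(0 <= k < j) (-1) ^+ k * inv_sum R n k.
Proof.
move=> m_gt0; under eq_bigr do rewrite inv_sum_alt mulrBr.
(* For j = 0 and j = 1 the inner q-logarithm sums are empty, which matches the range of
   [qlog_form]. *)
rewrite sumrB [X in _ - (_ - X)](big_cat_nat (n := 2)) //=.
rewrite [X in _ - (_ - (X + _))]big1_seq; last first.
  move=> j /andP[_]; rewrite mem_index_iota => /andP[_ lt_j2].
  by rewrite [X in _ * X]big_geq ?mulr0.
(* The binomial coefficients with j >= 1 sum to 2^m - 1; set against 2^m / 2^n, this leaves the
   single [(2 ^+ n)^-1] of [remainder]. *)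
have -> : \sum_(0 <= j < m.+1) 'C(m, j)%:R * ((0 < j)%N%:R * (2 ^+ n)^-1) =
    (2 ^+ m - 1) * (2 ^+ n)^-1 :> R.
  under eq_bigr do rewrite mulrA; rewrite -mulr_suml; congr (_ * _).
  rewrite big_ltn // mulr0 add0r; apply/eqP; rewrite eq_sym subr_eq; apply/eqP.
  rewrite addrC -natrX -[2%N]/(1 + 1)%N expnDn -(big_mkord xpredT (fun i =>
    'C(m, i) * (1 ^ (m - i) * 1 ^ i))%N) big_ltn // bin0 !exp1n natrD natr_sum.
  congr (_ + _); apply: eq_big_nat => -[//|i] _.
  by rewrite !exp1n !muln1 mulr1.
rewrite /remainder /qlog_form; ring.
Qed.

Lemma cvg_remainder n m : (0 < m <= 2 ^ n)%N ->
  (fun M => \sum_(0 <= i < M) alt_diff R m (2 ^ (n + i.+1))) @ \oo -->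
  remainder n m.
Proof.
move=> /andP[m_gt0 le_m]; rewrite remainderE //.
have -> : (fun M => \sum_(0 <= i < M) alt_diff R m (2 ^ (n + i.+1))) =
  (fun M => 2 ^+ m * (\sum_(0 <= i < M) alt_tail R (2 ^ (n + i.+1))) -
    \sum_(0 <= j < m.+1) 'C(m, j)%:R * \sum_(0 <= k < j) (-1) ^+ k *
      \sum_(0 <= i < M) (2 ^ (n + i.+1) + k)%:R^-1).
  apply/funext => M; under eq_bigr do rewrite alt_diff_expand.
  rewrite sumrB -mulr_sumr; congr (_ - _).
  rewrite exchange_big; apply: eq_bigr => j _; rewrite -mulr_sumr; congr (_ * _).
  by rewrite exchange_big; apply: eq_bigr => k _; rewrite -mulr_sumr.
apply: cvgB.
  apply: cvgM; first exact: cvg_cst.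
  under eq_fun do rewrite sum_alt_tail_pow2.
  apply: cvgD; last first.
    rewrite -[X in _ --> X]subr0; apply: cvgB; first exact: cvg_cst.
    exact: cvg_inv_pow2.
  apply: cvgD; last exact: cvg_cst.
  apply: cvgB; last exact: cvg_cst.
  exact: (cvg_comp _ _ (@cvg_expn_add n) (@cvg_gamma_seq R)).
apply: cvg_sum_nat => j /andP[_ lt_jm]; apply: cvgM; first exact: cvg_cst.
apply: cvg_sum_nat => k /andP[_ lt_kj]; apply: cvgM; first exact: cvg_cst.
(* k < j <= m <= 2^n keeps every k / 2^n below 1. *)
apply: cvg_sum_inv; apply: leq_trans lt_kj (leq_trans _ le_m).
by rewrite -ltnS.
Qed.

Lemma remainder_ge0 n m : (0 < m <= 2 ^ n)%N -> 0 <= remainder n m.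
Proof.
move=> /cvg_remainder cvg_r; rewrite -(cvg_lim _ cvg_r) //.
apply: limr_ge; first exact: cvgP cvg_r.
near=> M; rewrite sumr_ge0 // => i _; apply: alt_diff_ge0.
by rewrite expn_gt0.
Unshelve. all: by end_near.
Qed.

(** The term at a = 2^v is at most B(a, m+1) = B(a, m) - B(a + 1, m). As a + 1 <= 2a, this is at
    most B(a, m) - B(2a, m), and the sum over v telescopes. *)
Lemma remainder_le_beta n m : (0 < m <= 2 ^ n)%N ->
  remainder n m <= beta_val R m.-1 (2 ^ n.+1).
Proof.
move=> m_ok; have /andP[m_gt0 _] := m_ok; have cvg_r := cvg_remainder m_ok.
rewrite -(cvg_lim _ cvg_r) //; apply: limr_le; first exact: cvgP cvg_r.
near=> M.
suff : \sum_(0 <= i < M) alt_diff R m (2 ^ (n + i.+1)) <=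
    beta_val R m.-1 (2 ^ n.+1) - beta_val R m.-1 (2 ^ (n + M.+1)).
  move=> /le_trans; apply; rewrite gerBl; exact: beta_val_ge0.
elim: (M) => [|M' IHM]; first by rewrite big_geq // addn1 subrr.
rewrite big_nat_recr //=; apply: le_trans (lerD IHM (alt_diff_le_beta _ _ _)) _.
  by rewrite expn_gt0.
have := @beta_valS R m.-1 (2 ^ (n + M'.+1)); rewrite expn_gt0 prednK // => /(_ isT) <-.
have : beta_val R m.-1 (2 ^ (n + M'.+2)) <= beta_val R m.-1 (2 ^ (n + M'.+1)).+1.
  apply: beta_val_homo => //=; rewrite [(n + M'.+2)%N]addnS expnS.
  by have : (0 < 2 ^ (n + M'.+1))%N; [rewrite expn_gt0|lia].
by move=> le_b; lra.
Unshelve. all: by end_near.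
Qed.

(** With N = m + 1 this bounds B(2N, N). The ratio of consecutive values is at most its limit 4/27,
    the maximum of x^2 (1 - x) on [0, 1]. *)
Lemma beta_val_le m : beta_val R m (2 * m.+1) <= 6 * (4 / 27) ^+ m.+1.
Proof.
elim: m => [|m IHm].
  by rewrite /beta_val !factS fact0 /= expr1; lra.
suff -> : beta_val R m.+1 (2 * m.+2) = beta_val R m (2 * m.+1) *
    (m.+1%:R * (2 * m.+1)%:R * (2 * m.+1).+1%:R /
     ((3 * m).+3%:R * (3 * m).+4%:R * (3 * m).+4.+1%:R)).
  rewrite [_ ^+ m.+2]exprSr mulrA; apply: ler_pM => //.
    exact: beta_val_ge0.
  rewrite ler_pdivrMr // -!natrM.
  rewrite -[4 / 27 * _]mulrAC ler_pdivlMr // -!natrM ler_nat.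
  nia.
rewrite /beta_val.
have -> : (2 * m.+2).-1 = (2 * m).+3 by lia.
have -> : (2 * m.+1).-1 = (2 * m).+1 by lia.
have -> : (2 * m.+2 + m.+1 = (3 * m).+4.+1)%N by lia.
have -> : (2 * m.+1 + m = (3 * m).+2)%N by lia.
have -> : (2 * m.+1 = (2 * m).+2)%N by lia.
rewrite [(3 * m).+4.+1`!]factS [(3 * m).+4`!]factS [(3 * m).+3`!]factS.
rewrite [m.+1`!]factS [(2 * m).+3`!]factS [(2 * m).+2`!]factS.
move: ((3 * m).+2`!) (fact_gt0 (3 * m).+2) (m`!) ((2 * m).+1`!) => z z_gt0 u v.
have : z%:R != 0 :> R by rewrite pnatr_eq0 -lt0n.
have : (3 * m).+3%:R != 0 :> R by rewrite pnatr_eq0.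
have : (3 * m).+4%:R != 0 :> R by rewrite pnatr_eq0.
have : (3 * m).+4.+1%:R != 0 :> R by rewrite pnatr_eq0.
move: (3 * m).+3 (3 * m).+4 (3 * m).+4.+1 (2 * m).+2 (2 * m).+3 m.+1.
move=> a b c d e f; rewrite !natrM => c0 b0 a0 z0.
by field; rewrite z0 a0 b0 c0.
Qed.

Lemma lcm_upto_le M : (lcm_upto (2 * M))%:R <= 8 ^+ M :> R.
Proof.
have := cheb_psi_le_ln2 R (2 * M).
have -> : 3 / 2 * ln 2 * (2 * M)%:R = ln (2 ^+ 3 ^+ M) :> R.
  by rewrite -exprM lnXn // -mulr_natl !natrM; field.
rewrite /cheb_psi ler_ln ?posrE ?exprn_gt0 ?ltr0n ?lcm_upto_gt0 //.
by have -> : 2 ^+ 3 = 8 :> R by rewrite -natrX.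
Qed.

Lemma lcm_remainder_le n : (0 < n)%N ->
  (lcm_upto (2 ^ n))%:R * remainder n (2 ^ n) <= 6 * (128 / 729) ^+ (2 ^ n.-1).
Proof.
case: n => // n _ /=; set M := (2 ^ n)%N.
have M_gt0 : (0 < M)%N by rewrite expn_gt0.
have rem_ok : (0 < 2 ^ n.+1 <= 2 ^ n.+1)%N by rewrite expn_gt0 leqnn.
have le_beta : remainder n.+1 (2 ^ n.+1) <= 6 * (4 / 27) ^+ (2 * M).
  apply: le_trans (remainder_le_beta rem_ok) _.
  have := beta_val_le (2 * M).-1.
  by rewrite prednK ?muln_gt0 // -!expnS.
(* 128/729 = 8 (4/27)^2: the factor 8 comes from the least common multiple, the square from N =
   2M. *)
have -> : 6 * (128 / 729) ^+ M = 8 ^+ M * (6 * (4 / 27) ^+ (2 * M)) :> R.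
  by rewrite mulrCA exprM -exprMn; congr (_ * _ ^+ _); field.
rewrite [in lcm_upto _]expnS; apply: ler_pM => //; last exact: lcm_upto_le.
exact: remainder_ge0.
Qed.

(** * Integrality and fractional parts *)

Lemma lcm_harmonic_int N : exists z : int, (lcm_upto N)%:R * H N = z%:~R.
Proof.
rewrite /series /= mulr_sumr.
suff : (\sum_(0 <= k < N) (lcm_upto N)%:R * harmonic k : R) \is a Num.int.
  by move=> /intrP.
rewrite big_seq; apply: rpred_sum => k; rewrite mem_index_iota => /andP[_ lt_kN].
have /dvdnP[c ->] : (k.+1 %| lcm_upto N)%N by rewrite dvdn_lcm_upto.
by rewrite natrM mulfK ?pnatr_eq0 // rpred_nat.
Qed.

Lemma frac_part_le_remainder (x : R) (z : int) (y : R) :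
  0 <= y -> x = z%:~R + y -> frac_part x <= y.
Proof.
move=> y_ge0 ->; rewrite /frac_part.
have : z%:~R <= (Num.floor (z%:~R + y))%:~R :> R.
  by rewrite ler_int floor_ge_int lerDl.
by lra.
Qed.

Lemma gamma_denominator n (r : rat) : (0 < n)%N ->
  6 * (128 / 729 : R) ^+ (2 ^ n.-1) <
    frac_part ((lcm_upto (2 ^ n))%:R * qlog_form R n (2 ^ n)) ->
  euler_gamma R = ratr r ->
  ~ (`|denq r| %| 2 ^ (2 ^ n) * lcm_upto (2 ^ n))%N.
Proof.
move=> n_gt0 lt_frac gammaE /dvdnP[c def_c].
set N := (2 ^ n)%N in lt_frac def_c *; set d := lcm_upto N in lt_frac def_c *.
have rem_ok : (0 < N <= 2 ^ n)%N by rewrite expn_gt0 leqnn.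
have [h def_h] := lcm_harmonic_int N.
have /dvdnP[e def_e] : (N %| d)%N by rewrite dvdn_lcm_upto // leqnn andbT expn_gt0.
have N_neq0 : N%:R != 0 :> R by rewrite pnatr_eq0 -lt0n expn_gt0.
have gamma_int : 2 ^+ N * d%:R * euler_gamma R = (c%:Z * numq r)%:~R.
  rewrite -natrX -natrM def_c gammaE /ratr natrM intrM -mulrA; congr (_ * _).
  have -> : `|denq r|%N%:R = (denq r)%:~R :> R.
    by rewrite -[in RHS](gez0_abs (ltW (denq_gt0 r))).
  by rewrite mulrC divfK // intr_eq0 denq_neq0.
have := lcm_remainder_le n_gt0; rewrite leNgt => /negP; apply.
apply: lt_le_trans lt_frac _.
(* The integer part of the linear form times d is 2^N d H - d / N - 2^N d gamma, with h = d H, e = d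
   / N and [c * numq r] = 2^N d gamma. *)
apply: (@frac_part_le_remainder _ ((2 ^ N)%N%:Z * h - e%:Z - c%:Z * numq r)).
  by rewrite mulr_ge0 // remainder_ge0.
rewrite !intrB -gamma_int intrM -def_h -[(2 ^ N)%N%:Z%:~R]/((2 ^ N)%N%:R) natrX.
have -> : e%:Z%:~R = d%:R / N%:R :> R by rewrite def_e natrM mulfK.
rewrite /remainder -/N -/d.
by have -> : 2 ^+ n = N%:R :> R by [rewrite natrX]; ring.
Qed.

End Main.

Theorem theorem3 (R : realType) :
  (infinite_set [set n : nat | (0 < n)%N /\
      6 * (128 / 729 : R) ^+ (2 ^ n.-1) <
        frac_part ((lcm_upto (2 ^ n))%:R * qlog_form R n (2 ^ n))] ->
    irrational (euler_gamma R))
  /\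
  (forall n : nat, (0 < n)%N ->
    6 * (128 / 729 : R) ^+ (2 ^ n.-1) <
      frac_part ((lcm_upto (2 ^ n))%:R * qlog_form R n (2 ^ n)) ->
    forall r : rat, euler_gamma R = ratr r ->
      ~ (`|denq r| %| 2 ^ (2 ^ n) * lcm_upto (2 ^ n))%N).
Proof.
split; last by move=> n n_gt0 lt_frac r; apply: gamma_denominator.
move=> inf_n [r _ gammaE]; apply: inf_n.
(* Only n below the denominator can satisfy the inequality: for n at least the denominator, the
   latter is below 2^n and so divides d_(2^n). *)
apply: sub_finite_set (finite_II `|denq r|%N) => n [n_gt0 lt_frac] /=.
rewrite ltnNge; apply/negP => le_rn.
apply: (gamma_denominator n_gt0 lt_frac (esym gammaE)).
apply/dvdn_mull/dvdn_lcm_upto; rewrite absz_gt0 denq_neq0 /=.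
by apply: leq_trans le_rn (ltnW _); apply: ltn_expl.
Qed.
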